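(* Assume that the nested sets $\{X_\ell:1\le\ell\le L\}$ are quasi-uniform. Then, if the linear systems can be solved in linear time, the computation of all necessary coefficients of the multilevel cardinal basis $\{b_i^{(L)}:1\le i\le N_L\}$ can be done in $\mathcal{O}(N_L^2\log(N_L))$ time. Keeping these coefficients in memory needs $$\mathcal{O}\left(\sum_{\ell=1}^L(N_\ell-N_{\ell-1})\sum_{m=\ell}^LN_m\right)$$ space, where $N_0:=0$. A single point evaluation of $A_L(f)$ in nodal representation $A_L(f)(\boldsymbol{x})=\sum_{i=1}^{N_L}f(\boldsymbol{x}_i)b_i^{(L)}(\boldsymbol{x})$ takes $\mathcal{O}(N_L\log(N_L))$ time.
   Context: Let $\Omega\subseteq\mathbb{R}^d$ be a bounded domain and $X_1\subseteq X_2\subseteq\cdots\subseteq X_L\subseteq\Omega$ nested finite point sets, ordered so that $X_\ell=\{\boldsymbol{x}_1,\ldots,\boldsymbol{x}_{N_\ell}\}$ (distinct points). Fill distances and separation radii are $h_\ell=\sup_{\boldsymbol{x}\in\Omega}\min_{1\le i\le N_\ell}\|\boldsymbol{x}-\boldsymbol{x}_i\|_2$ and $q_\ell=\frac12\min_{i\ne j}\|\boldsymbol{x}_i-\boldsymbol{x}_j\|_2$ (minimum over $1\le i,j\le N_\ell$). Quasi-uniform means $q_\ell\le h_\ell\le c_{qu}q_\ell$ with a level-independent constant $c_{qu}>0$. Moreover $c\mu h_\ell\le h_{\ell+1}\le\mu h_\ell$ with fixed $\mu\in(0,1)$, $c\in(0,1]$. Let $\Phi:\mathbb{R}^d\to\mathbb{R}$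 be a positive definite radial basis function with support in the closed unit ball (continuous, with all matrices $(\Phi(\boldsymbol{y}_i-\boldsymbol{y}_j))_{i,j}$ for distinct points positive definite), and $\Phi_\ell=\delta_\ell^{-d}\Phi(\cdot/\delta_\ell)$, $\delta_\ell=\nu h_\ell$, with a fixed $\nu>1$. Let $W_\ell=\operatorname{span}\{\Phi_\ell(\cdot-\boldsymbol{x}_i):1\le i\le N_\ell\}$ and let $I_{X_\ell,\Phi_\ell}(g)\in W_\ell$ be the unique interpolant of $g\in C(\Omega)$ on $X_\ell$. For $f\in C(\Omega)$ put $e_0=f$, $s_\ell=I_{X_\ell,\Phi_\ell}(e_{\ell-1})$, $e_\ell=e_{\ell-1}-s_\ell$; the multilevel operator is $A_L(f)=\sum_{\ell=1}^Ls_\ell$, which depends only on $f|_{X_L}$. The multilevel cardinal basis function $b_i^{(L)}$ is $A_L(\chi_i^{(L)})$, where $\chi_i^{(L)}\in W_L$ satisfies $\chi_i^{(L)}(\boldsymbol{x}_j)=\delta_{ij}$ for $1\le j\le N_L$. Each $b_i^{(L)}$ is represented by coefficients via $b_i^{(L)}=\sum_{\ell=1}^L\sum_{j=1}^{N_\ell}\alpha_j^{(\ell)}\Phi_\ell(\cdot-\boldsymbol{x}_j)$, where the coefficient vectors $\boldsymbol\alpha^{(\ell)}\in\mathbb{R}^{N_\ell}$ (depending on $i$) are the unique solution of the lower block triangular system $$\sum_{m=1}^{\ell-1}B_{\ell m}\boldsymbol\alpha^{(m)}+M_\ell\boldsymbol\alpha^{(\ell)}=\chi_i^{(L)}|_{X_\ell},\qquad1\le\ell\le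 L,$$ with the interpolation matrices $M_\ell=(\Phi_\ell(\boldsymbol{x}_i-\boldsymbol{x}_j))_{1\le i,j\le N_\ell}$ and $B_{\ell m}=(\Phi_m(\boldsymbol{x}_i-\boldsymbol{x}_j))_{1\le i\le N_\ell,\,1\le j\le N_m}$ for $\ell>m$. If $\boldsymbol{x}_i\in X_\ell\setminus X_{\ell-1}$ (with $X_0:=\emptyset$), then $\boldsymbol\alpha^{(m)}=0$ for $m<\ell$, so only the blocks from level $\ell$ on need to be solved and stored; these are the necessary coefficients. ''Linear time'' means that a system with matrix $M_\ell$ can be solved in $\mathcal{O}(N_\ell)$ operations. Time is counted in arithmetic operations, space in numbers stored, and the constants in $\mathcal{O}(\cdot)$ are independent of $L$. *)

(* Defs.v *)
From mathcomp Require Import all_boot all_order all_algebra.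
From mathcomp Require Import all_classical all_reals all_analysis.
Set Implicit Arguments.
Unset Strict Implicit.
Unset Printing Implicit Defensive.
Import Order.TTheory GRing.Theory Num.Theory.
Import numFieldNormedType.Exports.
Local Open Scope classical_set_scope.
Local Open Scope ring_scope.

Section Kernel.
Context {R : realType} {d : nat}.

(* The library's norm on 'rV[R]_d is the maximum norm; it induces the same
   topology and the same bounded sets as this one. *)
Definition l2norm (u : 'rV[R]_d) : R := Num.sqrt (\sum_(k < d) u 0 k ^+ 2).

Definition bounded_domain (Omega : set 'rV[R]_d) : Prop :=
  [/\ open Omega, connected Omega, Omega !=set0 & bounded_set Omega].

Definition posdefmx (n : nat) (A : 'M[R]_n) : Prop :=
  A^T = A /\ forall v : 'cV[R]_n, v != 0 -> 0 < (v^T *m A *m v) 0 0.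

Record compact_pd_rbf (Phi : 'rV[R]_d -> R) : Prop := {
  rbf_radial : exists phi : R -> R, forall u, Phi u = phi (l2norm u);
  rbf_continuous : continuous Phi;
  rbf_support : closure [set u | Phi u != 0] `<=` [set u | l2norm u <= 1];
  rbf_posdef : forall (n : nat) (y : 'I_n -> 'rV[R]_d), injective y ->
    posdefmx (\matrix_(i, j) Phi (y i - y j))
}.

End Kernel.

(* Points are indexed from 0 and levels from 1: level l consists of the points
   x 0, ..., x (N l).-1, and N 0 = 0.  Only x 0, ..., x (N L).-1 and
   N 0, ..., N L are ever constrained or used. *)
Section Points.
Context {R : realType} {d : nat}.
Variables (Omega : set 'rV[R]_d) (x : nat -> 'rV[R]_d).

(* For 0 < n (resp. 1 < n) the infimum below is over a nonempty finite set and
   is therefore the minimum. *)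
Definition fill_distance (n : nat) : R :=
  sup [set inf [set l2norm (y - x i) | i in [set i | (i < n)%N]] | y in Omega].

Definition separation_radius (n : nat) : R :=
  2^-1 * inf [set l2norm (x p.1 - x p.2) |
               p in [set p : nat * nat |
                      [/\ (p.1 < n)%N, (p.2 < n)%N & p.1 != p.2]]].

Definition quasi_uniform (cqu : R) (n : nat) : Prop :=
  [/\ (1 < n)%N, separation_radius n <= fill_distance n
    & fill_distance n <= cqu * separation_radius n].

Definition level_sizes (L : nat) (N : nat -> nat) : Prop :=
  [/\ (0 < L)%N, N 0 = 0%N & forall l, (l < L)%N -> (N l <= N l.+1)%N].

Record nested_quasi_uniform (mu c cqu : R) (L : nat) (N : nat -> nat) : Prop := {
  points_in : forall i, (i < N L)%N -> Omega (x i);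
  points_distinct : forall i j, (i < N L)%N -> (j < N L)%N -> x i = x j -> i = j;
  points_quasi_uniform : forall l, (0 < l <= L)%N -> quasi_uniform cqu (N l);
  points_refine : forall l, (0 < l < L)%N ->
    c * mu * fill_distance (N l) <= fill_distance (N l.+1)
      <= mu * fill_distance (N l)
}.

End Points.

Section Multilevel.
Context {R : realType} {d : nat}.
Variables (Phi : 'rV[R]_d -> R) (delta : nat -> R).
Variables (N : nat -> nat) (x : nat -> 'rV[R]_d).

Definition scaled_kernel (l : nat) (u : 'rV[R]_d) : R :=
  (delta l ^+ d)^-1 * Phi ((delta l)^-1 *: u).

Definition approx_space (l : nat) : set ('rV[R]_d -> R) :=
  [set s | exists a : 'cV[R]_(N l),
     forall y, s y = \sum_(j < N l) a j 0 * scaled_kernel l (y - x j)].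

Definition interpolant (l : nat) (g : 'rV[R]_d -> R) : 'rV[R]_d -> R :=
  xget (fun=> 0) [set s | approx_space l s /\
                          forall i, (i < N l)%N -> s (x i) = g (x i)].

Fixpoint ml_error (f : 'rV[R]_d -> R) (l : nat) : 'rV[R]_d -> R :=
  match l with
  | 0 => f
  | k.+1 => fun y => ml_error f k y - interpolant k.+1 (ml_error f k) y
  end.

Definition multilevel (L : nat) (f : 'rV[R]_d -> R) : 'rV[R]_d -> R :=
  fun y => \sum_(1 <= l < L.+1) interpolant l (ml_error f l.-1) y.

Definition lagrange (L i : nat) : 'rV[R]_d -> R :=
  xget (fun=> 0) [set s | approx_space L s /\
                          forall j, (j < N L)%N -> s (x j) = (i == j)%:R].

Definition ml_cardinal (L i : nat) : 'rV[R]_d -> R :=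
  multilevel L (lagrange L i).

Definition interp_mx (l : nat) : 'M[R]_(N l) :=
  \matrix_(i, j) scaled_kernel l (x i - x j).

Definition cross_mx (l m : nat) : 'M[R]_(N l, N m) :=
  \matrix_(i, j) scaled_kernel m (x i - x j).

Definition block_system (L i : nat) (alpha : forall l, 'cV[R]_(N l)) : Prop :=
  forall l, (0 < l <= L)%N ->
    \sum_(1 <= m < l) cross_mx l m *m alpha m + interp_mx l *m alpha l
    = \col_k lagrange L i (x k).

(* The blocks of levels l, ..., L for each point x_i in X_l \ X_(l-1). *)
Definition necessary_coefs (L : nat)
    (alpha : nat -> forall l, 'cV[R]_(N l)) : seq R :=
  flatten [seq flatten [seq flatten [seq
      [seq alpha i m j 0 | j <- enum 'I_(N m)]
    | m <- index_iota l L.+1]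
    | i <- index_iota (N l.-1) (N l)]
    | l <- index_iota 1 L.+1].

End Multilevel.

(* Algebraic computation trees.  A program works on a memory of real numbers,
   read by address (out-of-range addresses read 0); each instruction appends its
   result to the memory.  The control flow depends on the data only through
   comparisons.  An arithmetic operation, a constant, a comparison and an
   evaluation of Phi at a point given by its d coordinates cost one operation;
   addressing is free.  [Solve l b p] solves the system with matrix M_l whose
   right-hand side is stored at the N l addresses b; its cost is a parameter. *)
Inductive arith : Type := Add | Sub | Mul | Div.

Inductive program (R : Type) : Type :=
| Return of seq nat
| Const of R & program R
| Arith of arith & nat & nat & program R
| Kernel of seq nat & program R
| IfLt of nat & nat & program R & program R
| Solve of nat & seq nat & program R.
Arguments Return {R} _.

Fixpoint solve_free (R : Type) (p : program R) : bool :=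
  match p with
  | Return _ => true
  | Const _ q | Arith _ _ _ q | Kernel _ q => solve_free q
  | IfLt _ _ q r => solve_free q && solve_free r
  | Solve _ _ _ => false
  end.

Section Run.
Context {R : realType} {d : nat}.
Variables (Phi : 'rV[R]_d -> R) (N : nat -> nat).
Variables (solver : forall l, 'cV[R]_(N l) -> 'cV[R]_(N l)) (tsolve : nat -> nat).

Definition arith_op (o : arith) (a b : R) : R :=
  match o with Add => a + b | Sub => a - b | Mul => a * b | Div => a / b end.

Definition read (s : seq R) (b : seq nat) (k : nat) : R := s`_(nth 0%N b k).

(* Returns the number of operations and the output. *)
Fixpoint run (p : program R) (s : seq R) : nat * seq R :=
  let tick t (r : nat * seq R) := ((t + r.1)%N, r.2) in
  match p with
  | Return b => (0%N, [seq s`_k | k <- b])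
  | Const a q => tick 1%N (run q (rcons s a))
  | Arith o i j q => tick 1%N (run q (rcons s (arith_op o s`_i s`_j)))
  | Kernel b q => tick 1%N (run q (rcons s (Phi (\row_(k < d) read s b k))))
  | IfLt i j q r => tick 1%N (if s`_i < s`_j then run q s else run r s)
  | Solve l b q =>
      let a := solver (\col_(k < N l) read s b k) in
      tick (tsolve l) (run q (s ++ [seq a j 0 | j <- enum 'I_(N l)]))
  end.

Definition linear_time_solver (M : forall l, 'M[R]_(N l)) (kappa : R)
    (L : nat) : Prop :=
  forall l, (0 < l <= L)%N ->
    (forall b : 'cV[R]_(N l), M l *m solver b = b) /\
    (tsolve l)%:R <= kappa * (N l)%:R.

End Run.

Section Inputs.
Context {R : realType} {d : nat}.

Definition coords (u : 'rV[R]_d) : seq R := [seq u 0 k | k <- enum 'I_d].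

(* The scaling parameters are part of the input: fill distances involve all of
   Omega and cannot be computed from the points alone. *)
Definition geometry_input (delta : nat -> R) (x : nat -> 'rV[R]_d) (L n : nat) :
    seq R :=
  [seq delta l | l <- index_iota 1 L.+1] ++
  flatten [seq coords (x i) | i <- iota 0 n].

(* The memory before an evaluation at y; [mem] are the stored coefficients. *)
Definition evaluation_input (delta : nat -> R) (x : nat -> 'rV[R]_d) (L n : nat)
    (mem : seq R) (f : 'rV[R]_d -> R) (y : 'rV[R]_d) : seq R :=
  geometry_input delta x L n ++ mem ++ [seq f (x i) | i <- iota 0 n] ++ coords y.

End Inputs.

(* Main.v *)
Require Import Defs.
From mathcomp Require Import all_boot all_order all_algebra.
From mathcomp Require Import all_classical all_reals all_analysis.
From mathcomp Require Import ring lra zify.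
From Stdlib Require List.
Set Implicit Arguments.
Unset Strict Implicit.
Unset Printing Implicit Defensive.
Import Order.TTheory GRing.Theory Num.Theory.
Import numFieldNormedType.Exports.
Local Open Scope classical_set_scope.
Local Open Scope ring_scope.

(** Two geometric facts make the multilevel scheme cheap.

    Sparsity.  Distinct points of level [l] are at least [2 q_l] apart, while
    the kernel of that level vanishes outside the ball of radius
    [nu h_l <= nu cqu q_l].  Sorting the points near [y] into grid cells smaller
    than the separation shows that only [B] of the numbers [Phi_l (y - x_j)] are
    nonzero, with [B] the same for all levels and all [y] ([neighbour_count]).

    Geometric growth.  Grid counting in a box around [Omega] and in a cube inside
    [Omega] gives [N_l h_l ^ d <= C] and [N_L h_L ^ d >= c].  As
    [h_L <= mu ^ (L - l) h_l], it follows that [N_l <= G mu ^ (L - l) N_L]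
    ([nested_card_growth]), hence [N_1 + ... + N_L = O(N_L)] and, taking [l = 1],
    [L = O(ln N_L)].

    The coefficients of one cardinal function come from forward substitution in
    the block triangular system, which may start at the first level containing
    its point because all blocks before it vanish.  The program first
    evaluates the kernels of all levels at all pairs of points and keeps the
    nonzero values, in [O(N_L * (N_1 + ... + N_L))] operations.  Then each entry of
    each right-hand side is a sum of at most [B L] products, so that one column
    takes [O(L * (N_1 + ... + N_L))] operations, solves included, and all columns
    together [O(N_L ^ 2 * L)].  An evaluation at [y] finds the neighbours of [y] in
    all levels in [O(N_1 + ... + N_L)] operations and then spends at most
    [B L] products on each of the [N_L] cardinal functions.

    That the computed numbers are the right ones is linear algebra: the
    interpolant depends linearly on the nodal values, so [A_L] is determined by,
    and linear in, the values of [f] on [X_L] ([multilevel_nodal]), and the block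
    system says exactly that the level [l] part of the expansion interpolates the
    error left by the previous levels ([ml_cardinal_expansion]).

    A program branches on comparisons, so which points are neighbours is known
    along each branch of its tree: writing program fragments in
    continuation-passing style ([builder]) lets them hand over neighbour lists as
    ordinary values, and [achieves] is a Hoare triple with a time bound for such
    fragments. *)

(** * Counting points with a grid *)

Section Pigeonhole.
Context {R : realType} {d : nat}.
Implicit Types (x : nat -> 'rV[R]_d) (y : 'rV[R]_d).

(** Constants do not matter, so distances are estimated coordinatewise; this lemma
    and the next one pass between coordinates and the Euclidean norm. *)
Lemma coord_le_l2norm (u : 'rV[R]_d) k : `|u 0 k| <= l2norm u.
Proof.
rewrite -sqrtr_sqr ler_wsqrtr// (bigD1 k)//= lerDl sumr_ge0// => j _.
exact: sqr_ge0.
Qed.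

Lemma l2norm_le (u : 'rV[R]_d) (a : R) :
  0 <= a -> (forall k, `|u 0 k| <= a) -> l2norm u <= d%:R * a.
Proof.
move=> a0 ua; rewrite -(ger0_norm (mulr_ge0 (ler0n R d) a0)) -sqrtr_sqr.
rewrite ler_wsqrtr//; apply: (@le_trans _ _ (\sum_(k < d) a ^+ 2)).
  apply: ler_sum => k _; rewrite -real_normK ?num_real//.
  by rewrite lerXn2r ?nnegrE ?ua.
rewrite sumr_const card_ord exprMn -[X in X <= _]mulr_natl.
rewrite ler_wpM2r ?sqr_ge0// -natrX ler_nat.
by case: (d) => // m; rewrite -{1}[m.+1]expn1 leq_pexp2l.
Qed.

(** Points in one cube of side [q / d] are within distance [q], so a set that is
    more than [q]-separated has at most one point per cube. *)
Lemma packing x (s : seq nat) y (rho q : R) :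
  (0 < d)%N -> 0 < q -> 0 <= rho -> uniq s ->
  (forall i j, i \in s -> j \in s -> i != j -> q < l2norm (x i - x j)) ->
  (forall i k, i \in s -> `|x i 0 k - y 0 k| <= rho) ->
  (size s)%:R <= (2 * rho * d%:R / q + 1) ^+ d.
Proof.
move=> d0 q0 rho0 us sep near.
have dR : 0 < d%:R :> R by rewrite ltr0n.
pose w := q / d%:R; have w0 : 0 < w by rewrite divr_gt0.
(* The box of side 2 rho consists of T + 1 cells per direction. *)
pose T := Num.truncn (2 * rho / w).
pose pos i k := (x i 0 k - y 0 k + rho) / w.
have pos_ge0 i k : i \in s -> 0 <= pos i k.
  move=> /near - /(_ k); rewrite ler_norml => /andP[lo _].
  by rewrite divr_ge0 ?(ltW w0)//; lra.
have pos_le i k : i \in s -> (Num.truncn (pos i k) < T.+1)%N.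
  move=> si; rewrite ltnS; apply: le_truncn.
  rewrite ler_pM2r ?invr_gt0//.
  by have := near _ k si; rewrite ler_norml => /andP[_]; lra.
pose cell i : {ffun 'I_d -> 'I_T.+1} := [ffun k => inord (Num.truncn (pos i k))].
have cell_inj : {in s &, injective cell}.
  move=> i j si sj eij; apply/eqP/negPn/negP => nij.
  have := sep i j si sj nij; apply/negP; rewrite -leNgt.
  have -> : q = d%:R * w by rewrite /w mulrC divfK// gt_eqF.
  apply: l2norm_le; first exact: ltW.
  move=> k; rewrite !mxE.
  have : val (cell i k) = val (cell j k) by rewrite eij.
  rewrite !ffunE /= !inordK ?pos_le// => etr.
  have /andP[i1 i2] := truncn_itv (pos_ge0 i k si).
  have /andP[j1 j2] := truncn_itv (pos_ge0 j k sj).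
  rewrite etr in i1 i2.
  have -> : x i 0 k - x j 0 k = (pos i k - pos j k) * w.
    by rewrite /pos -mulrBl divfK ?gt_eqF//; ring.
  rewrite normrM (gtr0_norm w0) ger_pMl// ler_norml.
  move: i1 i2 j1 j2; rewrite -natr1.
  move: (Num.truncn (pos j k))%:R (pos i k) => t a.
  move: (pos j k) => b *; apply/andP; split; lra.
have szle : (size s <= T.+1 ^ d)%N.
  rewrite -(size_map cell) -[X in (_ <= X ^ _)%N]card_ord.
  rewrite -[X in (_ <= _ ^ X)%N]card_ord -card_ffun.
  by apply/card_geqP; exists (map cell s); rewrite map_inj_in_uniq.
apply: (@le_trans _ _ ((T.+1 ^ d)%N%:R)); first by rewrite ler_nat.
have -> : 2 * rho * d%:R / q = 2 * rho / w.
  by rewrite /w; field; rewrite !gt_eqF.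
have rw0 : 0 <= 2 * rho / w by rewrite divr_ge0 ?mulr_ge0// ltW.
rewrite natrX lerXn2r ?nnegrE ?addr_ge0// -(natr1 T) lerD2r.
by have /andP[] := truncn_itv rw0.
Qed.

(** Grid points spaced by [2 h] cannot share a point at distance less than [h], so
    a set that comes that close to all of them has at least as many points. *)
Lemma covering (Omega : set 'rV[R]_d) x (p : 'rV[R]_d) (n : nat) (r h : R) :
  0 < r -> 0 < h ->
  (forall y, (forall k, `|y 0 k - p 0 k| <= r) -> Omega y) ->
  (forall y, Omega y -> exists2 i, (i < n)%N & l2norm (y - x i) < h) ->
  (r / (2 * h)) ^+ d <= n%:R.
Proof.
move=> r0 h0 cube cover.
pose T := Num.truncn (r / (2 * h)).
have h2 : 0 < 2 * h by lra.
have rh : 0 <= r / (2 * h) by rewrite divr_ge0// ltW.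
have /andP[T1 T2] := truncn_itv rh; rewrite -/T in T1 T2.
pose grid (t : {ffun 'I_d -> 'I_T.+1}) : 'rV[R]_d :=
  \row_k (p 0 k + (t k)%:R * (2 * h)).
have gridO t : exists i : 'I_n, l2norm (grid t - x i) < h.
  have /cover[i ilt ih] : Omega (grid t).
    apply: cube => k; rewrite !mxE addrAC subrr add0r ger0_norm; last first.
      by rewrite mulr_ge0// ltW.
    rewrite -ler_pdivlMr//; apply: le_trans T1.
    by rewrite ler_nat -ltnS.
  by exists (Ordinal ilt).
have [g gP] := choice gridO.
have g_inj : injective g.
  move=> t t' e; apply/ffunP => k; apply/val_inj/eqP/negPn/negP => ne.
  have := le_lt_trans (coord_le_l2norm _ k) (gP t).
  have := le_lt_trans (coord_le_l2norm _ k) (gP t').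
  rewrite e !mxE !ltr_norml => /andP[a1 a2] /andP[b1 b2].
  have [lt|gt|/eqP] := ltngtP (t k) (t' k); last by rewrite (negPf ne).
    have := lt; rewrite -(ler_nat R) -natr1.
    by rewrite -(ler_pM2r h2) mulrDl; lra.
  have := gt; rewrite -(ler_nat R) -natr1.
  by rewrite -(ler_pM2r h2) mulrDl; lra.
have := leq_card g g_inj; rewrite card_ffun !card_ord -(ler_nat R).
apply: le_trans; rewrite natrX lerXn2r ?nnegrE//.
exact: ltW.
Qed.

End Pigeonhole.

(** * Fill distance and separation radius *)

Section FillSep.
Context {R : realType} {d : nat}.
Variables (Omega : set 'rV[R]_d) (x : nat -> 'rV[R]_d).

Lemma l2norm_ge0 (u : 'rV[R]_d) : 0 <= l2norm u.
Proof. exact: sqrtr_ge0. Qed.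

Lemma l2norm0_eq0 (u : 'rV[R]_d) : l2norm u = 0 -> u = 0.
Proof.
move=> u0; apply/rowP => k; rewrite mxE; apply/eqP.
by rewrite -normr_eq0 eq_le normr_ge0 -{1}u0 coord_le_l2norm.
Qed.

Lemma separation_le n i j : (i < n)%N -> (j < n)%N -> i != j ->
  2 * separation_radius x n <= l2norm (x i - x j).
Proof.
move=> ilt jlt nij; rewrite /separation_radius mulrA divff ?pnatr_eq0// mul1r.
apply: ge_inf; last by exists (i, j).
by exists 0 => _ [p _ <-]; exact: l2norm_ge0.
Qed.

(** The infimum is over a finite set, and the smallest of the finitely many
    distances, which are all positive, bounds it from below. *)
Lemma separation_gt0 n : (1 < n)%N ->
  (forall i j, (i < n)%N -> (j < n)%N -> x i = x j -> i = j) ->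
  0 < separation_radius x n.
Proof.
move=> n1 dist; rewrite mulr_gt0 ?invr_gt0 ?ltr0n//.
pose e := \big[Num.min/1]_(p : 'I_n * 'I_n | p.1 != p.2) l2norm (x p.1 - x p.2).
apply: (@lt_le_trans _ _ e).
  apply/lt_bigmin; first exact: ltr01.
  move=> [i j] /= nij.
  rewrite lt_neqAle l2norm_ge0 andbT eq_sym; apply/eqP => /l2norm0_eq0/eqP.
  rewrite subr_eq0 => /eqP/(dist _ _ (ltn_ord i) (ltn_ord j))/val_inj eij.
  by rewrite eij eqxx in nij.
apply: lb_le_inf.
  by exists (l2norm (x 0%N - x 1%N)), (0, 1)%N => //; split => //; exact: ltnW.
move=> _ [[i j]/= [ilt jlt nij] <-].
exact: (@bigmin_le_cond _ _ _ _ (Ordinal ilt, Ordinal jlt) _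
          (fun p : 'I_n * 'I_n => l2norm (x p.1 - x p.2))).
Qed.

Lemma bounded_coord : bounded_set Omega ->
  exists2 M : R, 0 < M & forall y k, Omega y -> `|y 0 k| <= M.
Proof.
move=> [M [Mr bM]]; exists (`|M| + 1) => [|y k Oy]; first exact: ltr_wpDl.
have MM : M < `|M| + 1 by rewrite (le_lt_trans (ler_norm M))// ltrDl.
apply: le_trans (bM _ MM y Oy).
by rewrite [leRHS]/Num.norm /= mx_normrE; apply/bigmax_geP; right; exists (0, k).
Qed.

(** The factor 2 leaves room for an infimum, so that no minimum has to be attained. *)
Lemma fill_distance_cover n y : bounded_set Omega -> (0 < n)%N ->
  0 < fill_distance Omega x n -> Omega y ->
  exists2 i, (i < n)%N & l2norm (y - x i) < 2 * fill_distance Omega x n.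
Proof.
move=> /bounded_coord[M M0 bM] n0 h0 Oy.
set h := fill_distance _ _ _ in h0 *.
pose D z := [set l2norm (z - x i) | i in [set i | (i < n)%N]].
have Dinf z : has_inf (D z).
  split; first by exists (l2norm (z - x 0%N)), 0%N.
  by exists 0 => _ [i _ <-]; exact: l2norm_ge0.
have Dle : inf (D y) <= h.
  apply: sup_upper_bound; last by exists y.
  split; first by exists (inf (D y)), y.
  exists (d%:R * (M + \sum_k `|x 0%N 0 k|)) => _ [z Oz <-].
  apply: (@le_trans _ _ (l2norm (z - x 0%N))).
    by apply: ge_inf; [case: (Dinf z)|exists 0%N].
  apply: l2norm_le => [|k]; first by rewrite addr_ge0 ?(ltW M0)// sumr_ge0.
  rewrite !mxE; apply: le_trans (ler_normB _ _) _; apply: lerD; first exact: bM.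
  by rewrite (bigD1 k)//= lerDl sumr_ge0.
have [_ [i ilt <-] lt] := inf_adherent h0 (Dinf y).
by exists i => //; apply: lt_le_trans lt _; lra.
Qed.

End FillSep.

(** * Number of points and number of levels *)

Section Counting.
Context {R : realType} {d : nat}.
Variables (Omega : set 'rV[R]_d).
Hypotheses (d_gt0 : (0 < d)%N) (domOmega : bounded_domain Omega).

Let natd_gt0 : 0 < d%:R :> R. Proof. by rewrite ltr0n. Qed.

(** Packing in a box containing [Omega], with [h <= cqu q] to express the result
    through the fill distance. *)
Lemma quasi_uniform_card_le (cqu : R) : 0 < cqu ->
  exists2 C : R, 0 < C & forall x n,
    (forall i, (i < n)%N -> Omega (x i)) ->
    (forall i j, (i < n)%N -> (j < n)%N -> x i = x j -> i = j) ->
    quasi_uniform Omega x cqu n -> n%:R * fill_distance Omega x n ^+ d <= C.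
Proof.
move=> cqu0; have [_ _ _ /bounded_coord[M M0 bM]] := domOmega.
exists ((3 * M * d%:R * cqu) ^+ d); first by rewrite exprn_gt0// !mulr_gt0.
move=> x n inO dist [n1 qh hq].
set h := fill_distance _ _ _ in qh hq *.
have q0 := separation_gt0 n1 dist; set q := separation_radius _ _ in q0 qh hq.
have sep i j : (i < n)%N -> (j < n)%N -> i != j -> 2 * q <= l2norm (x i - x j).
  exact: separation_le.
(* Turns the + 1 of the packing bound into a factor. *)
have qM : q <= M * d%:R.
  suff : l2norm (x 0%N - x 1%N) <= d%:R * (M + M).
    by have := sep 0%N 1%N (ltnW n1) n1 isT; lra.
  apply: l2norm_le => [|k]; first by lra.
  rewrite !mxE; apply: le_trans (ler_normB _ _) _.
  by apply: lerD; apply: bM; apply: inO => //; exact: ltnW.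
have : (size (iota 0 n))%:R <= (2 * M * d%:R / q + 1) ^+ d.
  apply: (@packing _ _ x _ 0) => //; [exact: ltW|exact: iota_uniq| |].
    move=> i j; rewrite !mem_iota !add0n => ilt jlt nij.
    by apply: lt_le_trans (sep _ _ ilt jlt nij); lra.
  move=> i k; rewrite mem_iota add0n mxE subr0 => ilt.
  exact/bM/inO.
rewrite size_iota => nle.
have h0 : 0 < h by apply: lt_le_trans qh.
apply: (@le_trans _ _ ((2 * M * d%:R / q + 1) ^+ d * h ^+ d)).
  by rewrite ler_wpM2r// exprn_ge0// ltW.
have Mdq : 1 <= M * d%:R / q by rewrite ler_pdivlMr// mul1r.
rewrite -exprMn lerXn2r ?nnegrE//.
- by rewrite mulr_ge0 ?(ltW h0)//; lra.
- by rewrite ltW// !mulr_gt0.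
apply: (@le_trans _ _ (3 * (M * d%:R / q) * (cqu * q))).
  by apply: ler_pM => //; [lra|exact: ltW|lra].
rewrite le_eqVlt; apply/orP; left; apply/eqP; field; exact: lt0r_neq0.
Qed.

(** An open set contains a cube, to which the covering bound applies. *)
Lemma fill_distance_card_ge :
  exists2 c : R, 0 < c & forall x n, (0 < n)%N -> 0 < fill_distance Omega x n ->
    c <= n%:R * fill_distance Omega x n ^+ d.
Proof.
have [oO _ [p Op] bO] := domOmega.
have /nbhs_ballP[e /= e0 eO] := open_nbhs_nbhs (conj oO Op).
exists ((e / 8) ^+ d); first by rewrite exprn_gt0// divr_gt0.
move=> x n n0; set h := fill_distance _ _ _ => h0.
(* A cube of half the radius lies inside the open ball of radius e. *)
have : (e / 2 / (2 * (2 * h))) ^+ d <= n%:R.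
  apply: (@covering _ _ Omega x p); [by rewrite divr_gt0|by lra| |].
    move=> y near; apply: eO; rewrite mx_norm_ball /ball_ /=.
    rewrite [ltLHS]/Num.norm /= mx_normrE; apply/bigmax_ltP; split=> // -[i k] _.
    rewrite !mxE ord1 distrC (le_lt_trans (near k))//= ltr_pdivrMr//.
    by rewrite ltr_pMr// ltr1n.
  by move=> y Oy; apply: fill_distance_cover.
move=> nge.
have -> : (e / 8) ^+ d = (e / 2 / (2 * (2 * h))) ^+ d * h ^+ d.
  rewrite -exprMn; congr (_ ^+ _); field; exact: lt0r_neq0.
by rewrite ler_wpM2r// exprn_ge0// ltW.
Qed.

Section Levels.
Variables (mu c cqu : R) (L : nat) (N : nat -> nat) (x : nat -> 'rV[R]_d).
Hypotheses (mu01 : 0 < mu < 1) (levN : level_sizes L N).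
Hypothesis nqu : nested_quasi_uniform Omega x mu c cqu L N.

Lemma level_sizes_le l m : (l <= m <= L)%N -> (N l <= N m)%N.
Proof.
case: levN => _ _ mono /andP[]; elim: m => [|m IH]; first by case: l.
rewrite leq_eqVlt => /predU1P[->//|]; rewrite ltnS => lm mL.
exact: leq_trans (IH lm (ltnW mL)) (mono _ mL).
Qed.

Lemma level_points l : (0 < l <= L)%N ->
  [/\ (1 < N l)%N, 0 < separation_radius x (N l),
      forall i, (i < N l)%N -> Omega (x i) &
      forall i j, (i < N l)%N -> (j < N l)%N -> x i = x j -> i = j].
Proof.
move=> /andP[l0 lL]; have sub i : (i < N l)%N -> (i < N L)%N.
  by move/leq_trans; apply; apply: level_sizes_le; rewrite lL leqnn.
have dist i j : (i < N l)%N -> (j < N l)%N -> x i = x j -> i = j.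
  by move=> /sub ilt /sub jlt; apply: (points_distinct nqu).
have [n1 _ _] : quasi_uniform Omega x cqu (N l).
  by apply: (points_quasi_uniform nqu); rewrite l0.
by split=> // [|i /sub]; [exact: separation_gt0|exact: (points_in nqu)].
Qed.

Lemma level_fill_gt0 l : (0 < l <= L)%N -> 0 < fill_distance Omega x (N l).
Proof.
move=> lL; have [_ q0 _ _] := level_points lL.
by apply: lt_le_trans q0 _; case: (points_quasi_uniform nqu lL).
Qed.

Lemma fill_distance_decay l m : (0 < l)%N -> (l <= m <= L)%N ->
  fill_distance Omega x (N m) <= mu ^+ (m - l) * fill_distance Omega x (N l).
Proof.
case/andP: mu01 => mu0 _ l0 /andP[]; elim: m => [|m IH].
  by rewrite leqn0 => /eqP l00; rewrite l00 in l0.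
rewrite leq_eqVlt => /predU1P[->|]; first by rewrite subnn mul1r.
rewrite ltnS => lm mL; rewrite subSn// exprS -mulrA.
have /(points_refine nqu)/andP[_ /le_trans] : (0 < m < L)%N.
  by rewrite mL (leq_trans l0).
by apply; rewrite ler_pM2l// IH// ltnW.
Qed.

End Levels.

(** Both counts are of the order [h ^ - d].  The exponent [d] of [mu] is weakened to
    1, which still gives a geometric series. *)
Lemma nested_card_growth (mu cqu : R) : 0 < mu < 1 -> 0 < cqu ->
  exists2 G : R, 0 < G & forall c L N x, level_sizes L N ->
    nested_quasi_uniform Omega x mu c cqu L N ->
    forall l, (0 < l <= L)%N -> (N l)%:R <= G * mu ^+ (L - l) * (N L)%:R.
Proof.
move=> mu01 cqu0; have [mu0 mu1] := andP mu01.
have [C C0 leC] := quasi_uniform_card_le cqu0.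
have [b b0 geb] := fill_distance_card_ge.
exists (C / b) => [|c L N x levN nqu l lL]; first by rewrite divr_gt0.
have [L0 _ _] := levN; have LL : (0 < L <= L)%N by rewrite L0 leqnn.
have [n1 _ inO dist] := level_points levN nqu lL.
have [nL1 _ _ _] := level_points levN nqu LL.
have hl0 := level_fill_gt0 levN nqu lL.
have hL0 := level_fill_gt0 levN nqu LL.
have up := leC x _ inO dist (points_quasi_uniform nqu lL).
have lo := geb x _ (ltnW nL1) hL0.
have [l0 lleL] := andP lL.
have decay : fill_distance Omega x (N L) ^+ d
    <= mu ^+ (L - l) * fill_distance Omega x (N l) ^+ d.
  apply: (@le_trans _ _ ((mu ^+ (L - l) * fill_distance Omega x (N l)) ^+ d)).
    rewrite lerXn2r ?nnegrE ?(ltW hL0)//; last first.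
      by apply: (fill_distance_decay mu01 nqu l0); rewrite lleL leqnn.
    by rewrite mulr_ge0 ?(ltW hl0)// exprn_ge0// ltW.
  rewrite exprMn ler_wpM2r ?exprn_ge0 ?(ltW hl0)//.
  have mul0 : 0 <= mu ^+ (L - l) by rewrite exprn_ge0 ?(ltW mu0).
  have mul1 : mu ^+ (L - l) <= 1 by rewrite exprn_ile1 ?(ltW mu0) ?(ltW mu1).
  case: (d) d_gt0 => // k _; rewrite exprS ler_piMr// exprn_ile1//.
rewrite -(ler_pM2l b0).
have -> : b * (C / b * mu ^+ (L - l) * (N L)%:R) = (N L)%:R * mu ^+ (L - l) * C.
  by field; exact: lt0r_neq0.
apply: (@le_trans _ _ ((N L)%:R * fill_distance Omega x (N L) ^+ d * (N l)%:R)).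
  by rewrite ler_wpM2r.
rewrite -!mulrA ler_wpM2l//.
apply: (@le_trans _ _
   (mu ^+ (L - l) * fill_distance Omega x (N l) ^+ d * (N l)%:R)).
  by rewrite ler_wpM2r.
by rewrite -mulrA [_ ^+ d * _]mulrC ler_wpM2l// exprn_ge0// ltW.
Qed.

Lemma level_card_sum (mu cqu : R) : 0 < mu < 1 -> 0 < cqu ->
  exists2 G : R, 0 < G & forall c L N x, level_sizes L N ->
    nested_quasi_uniform Omega x mu c cqu L N ->
    (\sum_(1 <= l < L.+1) N l)%N%:R <= G * (N L)%:R.
Proof.
move=> mu01 cqu0; have [mu0 mu1] := andP mu01.
have [G G0 growth] := nested_card_growth mu01 cqu0.
have mu' : 0 < 1 - mu by lra.
exists (G / (1 - mu)) => [|c L N x levN nqu]; first by rewrite divr_gt0.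
have geom k : (1 - mu) * \sum_(1 <= l < k.+1) mu ^+ (k - l) = 1 - mu ^+ k.
  elim: k => [|k IH]; first by rewrite big_nil mulr0 expr0 subrr.
  rewrite big_nat_recr//= subnn expr0.
  have -> : \sum_(1 <= l < k.+1) mu ^+ (k.+1 - l)
          = mu * \sum_(1 <= l < k.+1) mu ^+ (k - l).
    rewrite big_distrr; apply: eq_big_nat => l /andP[_ lk].
    by rewrite subSn// exprS.
  by rewrite mulrDr mulrCA IH exprS; ring.
rewrite natr_sum; apply: (@le_trans _ _
   (\sum_(1 <= l < L.+1) G * mu ^+ (L - l) * (N L)%:R)).
  rewrite big_nat [leRHS]big_nat; apply: ler_sum => l lL.
  by apply: (growth c L N x).
rewrite -big_distrl -big_distrr /= ler_wpM2r// ler_wpM2l ?(ltW G0)//.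
rewrite -[leRHS]mul1r ler_pdivlMr// mulrC geom lerBlDr lerDl exprn_ge0//.
exact: ltW.
Qed.

(** Since [N_1 >= 1], the growth estimate between the levels 1 and [L] makes [N_L]
    exponentially large in [L].  The additive constants are absorbed because
    [ln N_L >= ln 2]. *)
Lemma level_count_log (mu cqu : R) : 0 < mu < 1 -> 0 < cqu ->
  exists2 G : R, 0 < G & forall c L N x, level_sizes L N ->
    nested_quasi_uniform Omega x mu c cqu L N -> L%:R <= G * ln (N L)%:R.
Proof.
move=> mu01 cqu0; have [mu0 mu1] := andP mu01.
have [G G0 growth] := nested_card_growth mu01 cqu0.
have lmu : 0 < - ln mu by rewrite oppr_gt0 ln_lt0.
have l2 : 0 < ln 2 :> R by rewrite ln_gt0// ltr1n.
exists ((ln 2)^-1 + (`|ln G| / ln 2 + 1) / (- ln mu)) => [|c L N x levN nqu].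
  by rewrite addr_gt0 ?invr_gt0// divr_gt0// ltr_wpDl// divr_ge0// ltW.
have [L0 _ _] := levN.
have L1 : (0 < 1 <= L)%N by [].
have LL : (0 < L <= L)%N by rewrite L0 leqnn.
have [n1 _ _ _] := level_points levN nqu L1.
have [nL1 _ _ _] := level_points levN nqu LL.
have nL0 : 0 < (N L)%:R :> R by rewrite ltr0n ltnW.
have lnN : ln 2 <= ln (N L)%:R :> R by rewrite ler_ln ?posrE// ler_nat.
have := growth c L N x levN nqu _ L1.
have n10 : 0 < (N 1%N)%:R :> R by rewrite ltr0n ltnW.
rewrite -ler_ln ?posrE ?mulr_gt0 ?exprn_gt0//.
rewrite !lnM ?posrE ?mulr_gt0 ?exprn_gt0// lnXn// => up.
have lo : 0 < ln (N 1%N)%:R :> R by rewrite ln_gt0// ltr1n.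
have main : (L - 1)%:R * - ln mu <= `|ln G| + ln (N L)%:R.
  move: up; rewrite -[X in _ <= _ + X + _]mulr_natl.
  by rewrite mulrN; have := ler_norm (ln G); lra.
have e1 : 1 <= (ln 2)^-1 * ln (N L)%:R :> R by rewrite mulrC ler_pdivlMr// mul1r.
have -> : L%:R = (L - 1)%:R + 1 :> R by rewrite natr1 subn1 prednK.
rewrite mulrDl addrC lerD// mulrAC ler_pdivlMr//.
apply: le_trans main _; rewrite mulrDl mul1r lerD2r.
by rewrite mulrAC ler_pdivlMr// ler_wpM2l.
Qed.

End Counting.

Section Neighbours.
Context {R : realType} {d : nat}.
Variables (Phi : 'rV[R]_d -> R) (nu cqu : R).
Hypotheses (d_gt0 : (0 < d)%N) (suppPhi : compact_pd_rbf Phi).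
Hypotheses (nu_gt1 : 1 < nu) (cqu0 : 0 < cqu).

(** The support radius [nu h_l] is at most a fixed multiple of the separation
    radius, so the packing bound does not depend on the level. *)
Lemma neighbour_count : exists K : nat,
  forall (Omega : set 'rV[R]_d) x mu c L N, level_sizes L N ->
  nested_quasi_uniform Omega x mu c cqu L N ->
  forall m y, (0 < m <= L)%N ->
  let delta l := nu * fill_distance Omega x (N l) in
  is_true (count (fun j => scaled_kernel Phi delta m (y - x j) != 0%R)
             (iota 0 (N m)) <= K)%N.
Proof.
pose B : R := (2 * (nu * cqu) * d%:R + 1) ^+ d.
exists (Num.truncn B) => Omega x mu c L N levN nqu m y mL delta.
have hm0 := level_fill_gt0 levN nqu mL.
have [n1 q0 inO dist] := level_points levN nqu mL.
have [_ _ hq] := points_quasi_uniform nqu mL.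
set q := separation_radius _ _ in q0 hq.
have nc0 : 0 < nu * cqu by rewrite mulr_gt0// (lt_trans ltr01).
have B0 : 0 <= B by rewrite exprn_ge0// addr_ge0// mulr_ge0// mulr_ge0// ltW.
rewrite truncn_ge_nat// -size_filter.
have -> : B = (2 * (nu * cqu * q) * d%:R / q + 1) ^+ d.
  by rewrite /B; congr (_ ^+ _); field; exact: lt0r_neq0.
apply: (@packing _ _ x _ y) => //.
- by rewrite mulr_ge0// ltW.
- exact/filter_uniq/iota_uniq.
- move=> i j; rewrite !mem_filter !mem_iota !add0n => /andP[_ ilt] /andP[_ jlt] nij.
  by apply: lt_le_trans (separation_le x ilt jlt nij); rewrite -/q; lra.
move=> i k; rewrite mem_filter => /andP[nz _].
have d0 : 0 < delta m by rewrite mulr_gt0// (lt_trans ltr01).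
have : l2norm ((delta m)^-1 *: (y - x i)) <= 1.
  apply: (rbf_support suppPhi); apply: subset_closure => /=.
  by move: nz; rewrite /scaled_kernel mulf_eq0 negb_or => /andP[].
move=> /(le_trans (coord_le_l2norm _ k)); rewrite !mxE normrM normfV.
rewrite (gtr0_norm d0) mulrC ler_pdivrMr// mul1r distrC => /le_trans; apply.
by rewrite /delta -mulrA ler_wpM2l// ltW// (lt_trans ltr01).
Qed.

End Neighbours.

(** * Interpolation and the multilevel operator *)

Section Interpolation.
Context {R : realType} {d : nat}.
Variables (Phi : 'rV[R]_d -> R) (delta : nat -> R).
Variables (N : nat -> nat) (x : nat -> 'rV[R]_d) (L : nat).
Variable solver : forall l, 'cV[R]_(N l) -> 'cV[R]_(N l).
Hypothesis levN : level_sizes L N.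
Hypothesis solverP : forall l, (0 < l <= L)%N ->
  forall b, interp_mx Phi delta N x l *m solver b = b.

Local Notation K := (scaled_kernel Phi delta).
Local Notation M := (interp_mx Phi delta N x).

Definition expansion l (a : 'cV[R]_(N l)) : 'rV[R]_d -> R :=
  fun y => \sum_(j < N l) a j 0 * K l (y - x j).

(** The solver is a right inverse, and a square matrix with a right inverse is
    invertible. *)
Lemma interp_mx_unit l : (0 < l <= L)%N -> M l \in unitmx.
Proof.
move=> lL; pose S := \matrix_(i, j) (solver (delta_mx j 0 : 'cV_(N l)) i 0).
have /mulmx1_unit[] // : M l *m S = 1%:M.
apply/matrixP => i j; have := solverP lL (delta_mx j 0).
move/matrixP => /(_ i 0); rewrite !mxE eqxx andbT => <-.
by apply: eq_bigr => k _; rewrite [S _ _]mxE.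
Qed.

Lemma solver_interp_mx l a : (0 < l <= L)%N -> solver (M l *m a) = a.
Proof.
move=> lL; have := solverP lL (M l *m a).
by move/(congr1 (mulmx (invmx (M l)))); rewrite !mulKmx// interp_mx_unit.
Qed.

Lemma expansion_node l (a : 'cV[R]_(N l)) m (k : 'I_(N m)) :
  expansion a (x k) = (cross_mx Phi delta N x m l *m a) k 0.
Proof. by rewrite mxE; apply: eq_bigr => j _; rewrite mxE mulrC. Qed.

Lemma expansion_interpolates l (s g : 'rV[R]_d -> R) (a : 'cV[R]_(N l)) :
  (0 < l <= L)%N -> s = expansion a ->
  (forall k : 'I_(N l), s (x k) = g (x k)) -> a = solver (\col_(k < N l) g (x k)).
Proof.
move=> lL -> sg; rewrite -[LHS](solver_interp_mx _ lL); congr solver.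
by apply/colP => k; rewrite [RHS]mxE -sg expansion_node.
Qed.

Lemma solver_expansion l (g : 'rV[R]_d -> R) (k : nat) : (0 < l <= L)%N ->
  (k < N l)%N -> expansion (solver (\col_(k < N l) g (x k))) (x k) = g (x k).
Proof.
move=> lL kl; rewrite (expansion_node _ (Ordinal kl)).
by have /colP/(_ (Ordinal kl)) := solverP lL (\col_(k < N l) g (x k)); rewrite [RHS]mxE.
Qed.

(** The set in [interpolant] is a singleton, so the choice made there is the
    expansion computed by the solver. *)
Lemma xget_expansion l (g : 'rV[R]_d -> R) : (0 < l <= L)%N ->
  xget (fun=> 0) [set s | approx_space Phi delta N x l s /\
                          forall k, (k < N l)%N -> s (x k) = g (x k)]
  = expansion (solver (\col_(k < N l) g (x k))).
Proof.
move=> lL; apply: xget_unique => /=.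
  by split=> [|k kl]; [eexists => y|exact: solver_expansion].
move=> s [[a sa] sg]; have se : s = expansion a by apply/funext.
by rewrite -(expansion_interpolates lL se) // => k; exact: sg.
Qed.

Lemma interpolantE l g : (0 < l <= L)%N ->
  interpolant Phi delta N x l g = expansion (solver (\col_(k < N l) g (x k))).
Proof. exact: xget_expansion. Qed.

Lemma interpolant_unique l g (a : 'cV[R]_(N l)) : (0 < l <= L)%N ->
  (forall k : 'I_(N l), expansion a (x k) = g (x k)) ->
  interpolant Phi delta N x l g = expansion a.
Proof.
by move=> lL ag; rewrite interpolantE// -(expansion_interpolates lL erefl ag).
Qed.

(** Linearity in the nodal values: only the values of [g] and [gs i] on the points of
    level [l] enter, so the hypothesis is stated there. *)
Lemma interpolant_sum n l (c : 'I_n -> R) g (gs : 'I_n -> 'rV[R]_d -> R) :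
  (0 < l <= L)%N ->
  (forall k, (k < N l)%N -> g (x k) = \sum_i c i * gs i (x k)) ->
  forall y, interpolant Phi delta N x l g y
            = \sum_i c i * interpolant Phi delta N x l (gs i) y.
Proof.
move=> lL gE y.
pose a : 'cV_(N l) := \sum_i c i *: solver (\col_(k < N l) gs i (x k)).
have aE z : expansion a z = \sum_i c i * interpolant Phi delta N x l (gs i) z.
  rewrite [RHS](eq_bigr
    (fun i => c i * expansion (solver (\col_(k < N l) gs i (x k))) z)).
    rewrite /expansion; under [RHS]eq_bigr do rewrite mulr_sumr.
    rewrite exchange_big; apply: eq_bigr => j _.
    by rewrite summxE mulr_suml; apply: eq_bigr => i _; rewrite mxE mulrA.
  by move=> i _; rewrite interpolantE.
rewrite -aE -(@interpolant_unique _ g)// => k; rewrite aE gE//.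
by apply: eq_bigr => i _; rewrite interpolantE// solver_expansion.
Qed.

Lemma lagrange_node i k : (i < N L)%N -> (k < N L)%N ->
  Defs.lagrange Phi delta N x L i (x k) = (i == k)%:R.
Proof.
case: levN => L0 _ _ iL kL; have LL : (0 < L <= L)%N by rewrite L0 leqnn.
pose b : 'cV[R]_(N L) := \col_k (i == k)%:R.
have [|_ vals] := xgetPex (fun=> 0) (P := [set s |
  approx_space Phi delta N x L s /\
  forall j, (j < N L)%N -> s (x j) = (i == j)%:R]); last exact: vals.
exists (expansion (solver b)); split=> [|j jL]; first by eexists.
rewrite (expansion_node _ (Ordinal jL)).
by have /colP/(_ (Ordinal jL)) := solverP LL b; rewrite [RHS]mxE.
Qed.

Lemma ml_errorE f l y : ml_error Phi delta N x f l y =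
  f y - \sum_(1 <= m < l.+1)
          interpolant Phi delta N x m (ml_error Phi delta N x f m.-1) y.
Proof.
elim: l => [|l IH]; first by rewrite big_nil subr0.
by rewrite big_nat_recr//= IH opprD addrA.
Qed.

(** On [X_L] the function [f] is the combination of the Lagrange functions with
    coefficients [f (x i)]; by linearity of interpolation this relation passes to
    the errors of all levels, again on [X_L] only. *)
Lemma multilevel_nodal f y : multilevel Phi delta N x L f y =
  \sum_(i < N L) f (x i) * ml_cardinal Phi delta N x L i y.
Proof.
have err l : (l <= L)%N -> forall k, (k < N L)%N -> ml_error Phi delta N x f l (x k)
    = \sum_(i < N L) f (x i) *
        ml_error Phi delta N x (Defs.lagrange Phi delta N x L i) l (x k).
  elim: l => [_ k kL|l IH lL k kL].
    rewrite (bigD1 (Ordinal kL))//= lagrange_node// eqxx mulr1.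
    rewrite big1 ?addr0// => i nik; rewrite lagrange_node//.
    by rewrite -[k]/(val (Ordinal kL)) val_eqE (negPf nik) mulr0.
  rewrite /= IH ?(ltnW lL)//.
  rewrite (interpolant_sum (c := fun i : 'I_(N L) => f (x i)) _
    (gs := fun i => ml_error Phi delta N x (Defs.lagrange Phi delta N x L i) l)) //.
    by rewrite -sumrB; apply: eq_bigr => i _; rewrite mulrBr.
  move=> j jl; apply: IH; first exact: ltnW.
  by apply: leq_trans jl _; apply: (level_sizes_le levN); rewrite lL leqnn.
rewrite /multilevel /ml_cardinal /multilevel.
under [RHS]eq_bigr do rewrite mulr_sumr.
rewrite exchange_big; apply: eq_big_nat => l /andP[l0 lL].
have lL' : (0 < l <= L)%N by rewrite l0.
apply: interpolant_sum => // k kl; apply: err.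
  by rewrite (leq_trans (leq_pred l)).
by apply: leq_trans kl _; apply: (level_sizes_le levN); rewrite leqnn andbT.
Qed.

(** By induction on [l], row [k] of the block equation of level [l] says that the
    expansion with coefficients [alpha l] agrees at [x k] with the error left by the
    previous levels, so it is the interpolant of that error. *)
Lemma ml_cardinal_expansion i (alpha : forall l, 'cV[R]_(N l)) y :
  block_system Phi delta x L i alpha ->
  ml_cardinal Phi delta N x L i y = \sum_(1 <= l < L.+1) expansion (alpha l) y.
Proof.
move=> sys; apply: eq_big_nat => l; rewrite ltnS => lL; move: y.
suff -> : interpolant Phi delta N x l
   (ml_error Phi delta N x (Defs.lagrange Phi delta N x L i) l.-1)
   = expansion (alpha l) by [].
elim/ltn_ind: l lL => l IH lL; apply: interpolant_unique => // k.
rewrite ml_errorE prednK; last by case/andP: lL.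
have /colP/(_ k) := sys l lL; rewrite [RHS]mxE => <-.
rewrite mxE summxE expansion_node addrAC -[LHS]add0r; congr (_ + _).
apply/esym/eqP; rewrite subr_eq0; apply/eqP/eq_big_nat => m /andP[m0 ml].
rewrite IH// ?expansion_node// m0.
by case/andP: lL => _; apply: leq_trans; exact: ltnW.
Qed.

(** Forward substitution refers to all earlier blocks; [fuel] turns this into a
    structural recursion, and all values above [l] give the same vector. *)
Fixpoint ml_coef_upto (i fuel l : nat) : 'cV[R]_(N l) :=
  if fuel is p.+1 then
    solver (\col_k Defs.lagrange Phi delta N x L i (x k)
            - \sum_(1 <= m < l) cross_mx Phi delta N x l m *m ml_coef_upto i p m)
  else 0.

Definition ml_coef i l : 'cV[R]_(N l) := ml_coef_upto i l.+1 l.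

Lemma ml_coefE i l : ml_coef i l =
  solver (\col_k Defs.lagrange Phi delta N x L i (x k)
          - \sum_(1 <= m < l) cross_mx Phi delta N x l m *m ml_coef i m).
Proof.
have stable p m : (m < p)%N -> ml_coef_upto i p m = ml_coef i m.
  elim/ltn_ind: p m => -[//|p] IH m; rewrite ltnS => mp.
  rewrite /ml_coef /=; congr (solver (_ - _)); apply: eq_big_nat => j /andP[_ jm].
  by rewrite !IH// (leq_trans jm).
rewrite {1}/ml_coef /=; congr (solver (_ - _)); apply: eq_big_nat => j /andP[_ jm].
by rewrite stable.
Qed.

Lemma ml_coef_block_system i : block_system Phi delta x L i (ml_coef i).
Proof. by move=> l lL; rewrite [ml_coef i l]ml_coefE solverP// addrC subrK. Qed.

(** The right-hand side vanishes at levels not containing [x i], so the zero blocks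
    propagate by uniqueness. *)
Lemma ml_coef_eq0 i m : (i < N L)%N -> (0 < m <= L)%N -> (N m <= i)%N ->
  ml_coef i m = 0.
Proof.
move=> iL; elim/ltn_ind: m => m IH mL Nmi.
have [m0 mleL] := andP mL.
rewrite ml_coefE -[RHS](solver_interp_mx _ mL) mulmx0; congr solver.
rewrite big_nat big1 ?subr0 => [|l /andP[l0 lm]].
  apply/colP => k; rewrite !mxE lagrange_node//.
    by rewrite gtn_eqF// (leq_trans _ Nmi).
  by apply: leq_trans (ltn_ord k) (level_sizes_le levN _); rewrite mleL leqnn.
rewrite IH ?mulmx0// ?l0 ?(leq_trans (ltnW lm))//.
by apply: leq_trans (level_sizes_le levN _) Nmi; rewrite (ltnW lm).
Qed.

End Interpolation.

(** * Memory and program builders *)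

Section Memory.
Context {R : realType}.
Implicit Types (s e : seq R) (l : seq nat) (v : seq R).

(** The addresses [l] are already written and hold the values [v]; as the memory only
    grows, this persists ([stores_cat]). *)
Definition stores s l v : Prop :=
  all (fun k => k < size s)%N l /\ [seq s`_k | k <- l] = v.

Lemma stores_cat s e l v : stores s l v -> stores (s ++ e) l v.
Proof.
move=> [/allP ls <-]; split.
  by apply/allP => k /ls /= ks; rewrite size_cat ltn_addr.
by apply/eq_in_map => k /ls ks; rewrite nth_cat ks.
Qed.

Lemma stores_size s l v : stores s l v -> size l = size v.
Proof. by move=> [_ <-]; rewrite size_map. Qed.

Lemma stores_nth s l v k : stores s l v -> (k < size v)%N ->
  stores s [:: nth 0%N l k] [:: v`_k].
Proof.
move=> /[dup] /stores_size lv [/allP ls <-]; rewrite size_map => kl.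
by split=> /=; rewrite ?(nth_map 0%N)// andbT ls// mem_nth.
Qed.

Lemma stores_nth1 s l v k : stores s l v -> (k < size v)%N ->
  s`_(nth 0%N l k) = v`_k.
Proof. by move=> sl kv; have [_ []] := stores_nth sl kv. Qed.

Lemma stores_append s l v l' v' : stores s l v -> stores s l' v' ->
  stores s (l ++ l') (v ++ v').
Proof. by move=> [a <-] [b <-]; split; rewrite ?all_cat ?a// map_cat. Qed.

(** The layout of a block structured memory is obtained by reshaping its address
    range in the same way as its contents. *)
Lemma stores_block s l (vs : seq (seq R)) n : stores s l (flatten vs) ->
  stores s (nth [::] (reshape (shape vs) l) n) (nth [::] vs n).
Proof.
move=> [/allP ls lE]; rewrite -{2}(flattenK vs) -lE !nth_reshape.
split; last by rewrite map_take map_drop.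
by apply/allP => k /mem_take/mem_drop/ls.
Qed.

Lemma stores_map (T : Type) (g : T -> R) s (xs : seq T) l :
  List.Forall2 (fun x a => stores s [:: a] [:: g x]) xs l ->
  stores s l [seq g x | x <- xs].
Proof.
elim=> {xs l} [|x a xs l ha _ IH]; first by split.
exact: (stores_append ha IH).
Qed.

Lemma stores_flatten (T : Type) (g : T -> seq R) s (xs : seq T) ls :
  List.Forall2 (fun x l => stores s l (g x)) xs ls ->
  stores s (flatten ls) (flatten [seq g x | x <- xs]).
Proof.
elim=> {xs ls} [|x a xs l ha _ IH]; first by split.
exact: stores_append.
Qed.

End Memory.

Lemma Forall2_nth (A B : Type) (P : A -> B -> Prop) (l : seq A) (l' : seq B)
    x0 y0 n : List.Forall2 P l l' -> (n < size l)%N -> P (nth x0 l n) (nth y0 l' n).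
Proof. by move=> H; elim: H n => //= x y k k' pxy _ IH [|n]//; exact: IH. Qed.

Section Builders.
Context {R : realType}.

(** A program fragment that returns a value of type [A] to the rest of the program.
    The number is the current size of the memory, hence the address of the next
    result. *)
Definition builder (A : Type) := nat -> (nat -> A -> program R) -> program R.

Definition ret A (a : A) : builder A := fun n k => k n a.

Definition bind A B (m : builder A) (f : A -> builder B) : builder B :=
  fun n k => m n (fun n' a => f a n' k).

Definition const (r : R) : builder nat := fun n k => Const r (k n.+1 n).

Definition op (o : arith) (i j : nat) : builder nat :=
  fun n k => Arith o i j (k n.+1 n).

Definition phi (b : seq nat) : builder nat := fun n k => Defs.Kernel b (k n.+1 n).

Definition solve (N : nat -> nat) l (b : seq nat) : builder (seq nat) :=
  fun n k => Solve l b (k (n + N l)%N (iota n (N l))).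

(** Inequality is decided by the two strict comparisons.  Comparisons append
    nothing, so all branches continue with the same memory size. *)
Definition differ (i j : nat) : builder bool := fun n k =>
  IfLt i j (k n true) (IfLt j i (k n true) (k n false)).

Fixpoint foreach A B (f : A -> builder B) (l : seq A) : builder (seq B) :=
  if l is x :: l' then
    bind (f x) (fun b => bind (foreach f l') (fun bs => ret (b :: bs)))
  else ret [::].

Fixpoint loop A S (f : A -> S -> builder S) (l : seq A) (st : S) : builder S :=
  if l is x :: l' then bind (f x st) (loop f l') else ret st.

Definition output (m : builder (seq nat)) (n : nat) : program R :=
  m n (fun _ => Return).

(** Absence of [Solve] is stated for all continuations so that it composes. *)
Definition no_solve A (m : builder A) : Prop := forall n k,
  (forall n' a, solve_free (k n' a)) -> solve_free (m n k).

Lemma no_solve_bind A B (m : builder A) (f : A -> builder B) :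
  no_solve m -> (forall a, no_solve (f a)) -> no_solve (bind m f).
Proof. by move=> mS fS n k kS; apply: mS => n' a; exact: fS. Qed.

Lemma no_solve_foreach A B (f : A -> builder B) l :
  (forall a, no_solve (f a)) -> no_solve (foreach f l).
Proof.
move=> fS; elim: l => [|x l IH] /=; first by move=> n k; exact.
apply: no_solve_bind => // b; apply: no_solve_bind => // bs.
by move=> n k; exact.
Qed.

Lemma no_solve_loop A S (f : A -> S -> builder S) l st :
  (forall a st, no_solve (f a st)) -> no_solve (loop f l st).
Proof.
move=> fS; elim: l st => [|x l IH] st /=; first by move=> n k; exact.
exact: no_solve_bind.
Qed.

Section Semantics.
Context {d : nat}.
Variables (Phi : 'rV[R]_d -> R) (N : nat -> nat).
Variables (solver : forall l, 'cV[R]_(N l) -> 'cV[R]_(N l)) (tsolve : nat -> nat).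

Local Notation run := (run Phi solver tsolve).

(** A total-correctness triple with time bound [t]: on memory [s] the fragment hands
    over to its continuation in at most [t] operations, with a result and an
    extended memory satisfying [Q]. *)
Definition achieves A (m : builder A) (s : seq R) (t : nat)
    (Q : A -> seq R -> Prop) : Prop :=
  exists a e t', [/\ (t' <= t)%N, Q a (s ++ e) &
    forall k, run (m (size s) k) s =
      (let r := run (k (size (s ++ e)) a) (s ++ e) in ((t' + r.1)%N, r.2))].

Lemma achieves_weaken A (m : builder A) s t t' (Q Q' : A -> seq R -> Prop) :
  (t <= t')%N -> (forall a e, Q a (s ++ e) -> Q' a (s ++ e)) ->
  achieves m s t Q -> achieves m s t' Q'.
Proof.
move=> tt' QQ' [a [e [u [ut Qa mE]]]]; exists a, e, u; split=> //.
  exact: leq_trans tt'.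
exact: QQ'.
Qed.

Lemma achieves_ret A (a : A) s (Q : A -> seq R -> Prop) :
  Q a s -> achieves (ret a) s 0 Q.
Proof.
move=> Qa; exists a, [::], 0%N; rewrite cats0; split=> // k.
by rewrite /ret; case: run.
Qed.

Lemma achieves_bind A B (m : builder A) (f : A -> builder B) s t t'
    (Q : A -> seq R -> Prop) (Q' : B -> seq R -> Prop) :
  achieves m s t Q ->
  (forall a e, Q a (s ++ e) -> achieves (f a) (s ++ e) t' Q') ->
  achieves (bind m f) s (t + t') Q'.
Proof.
move=> [a [e [u [ut Qa mE]]]] /(_ a e Qa)[b [e' [u' [ut' Qb fE]]]].
exists b, (e ++ e'), (u + u')%N; rewrite catA; split=> //; first exact: leq_add.
by move=> k; rewrite /bind mE fE /= addnA.
Qed.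

(** All instructions with a result only append to the memory, in a fixed amount of
    time. *)
Lemma achieves_append A (m : builder A) s (a : A) (v : seq R) t
    (Q : A -> seq R -> Prop) :
  (forall k, run (m (size s) k) s =
    (let r := run (k (size s + size v)%N a) (s ++ v) in ((t + r.1)%N, r.2))) ->
  Q a (s ++ v) -> achieves m s t Q.
Proof. by move=> mE Qa; exists a, v, t; split=> // k; rewrite mE size_cat. Qed.

Lemma stores_new (s v : seq R) : stores (s ++ v) (iota (size s) (size v)) v.
Proof.
split; first by apply/allP => k; rewrite mem_iota size_cat => /andP[].
apply: (@eq_from_nth _ 0) => [|i]; rewrite size_map size_iota// => iv.
by rewrite (nth_map 0%N) ?size_iota// nth_iota// nth_cat ltnNge leq_addr addKn.
Qed.

Lemma achieves_const r s :
  achieves (const r) s 1 (fun a s' => stores s' [:: a] [:: r]).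
Proof.
apply: (achieves_append (v := [:: r])) => [k|]; last exact: stores_new.
by rewrite /const /= -cats1 addn1.
Qed.

Lemma achieves_op o i j s u w : stores s [:: i] [:: u] -> stores s [:: j] [:: w] ->
  achieves (op o i j) s 1 (fun a s' => stores s' [:: a] [:: arith_op o u w]).
Proof.
move=> [_ [<-]] [_ [<-]].
apply: (achieves_append (v := [:: arith_op o s`_i s`_j])) => [k|].
  by rewrite /op /= -cats1 addn1.
exact: stores_new.
Qed.

Lemma size_coords (u : 'rV[R]_d) : size (coords u) = d.
Proof. by rewrite size_map size_enum_ord. Qed.

Lemma nth_coords (u : 'rV[R]_d) (j : 'I_d) : (coords u)`_j = u 0 j.
Proof. by rewrite (nth_map j) ?size_enum_ord// nth_ord_enum. Qed.

Lemma achieves_phi b s u : stores s b (coords u) ->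
  achieves (phi b) s 1 (fun a s' => stores s' [:: a] [:: Phi u]).
Proof.
move=> sb; apply: (achieves_append (v := [:: Phi u])) => [k|];
  last exact: stores_new.
have bu : \row_(k < d) read s b k = u.
  by apply/rowP => j; rewrite mxE /read (stores_nth1 sb) ?nth_coords ?size_coords.
by rewrite /phi /= bu -cats1 addn1.
Qed.

Definition column_values n (a : 'cV[R]_n) : seq R := [seq a j 0 | j <- enum 'I_n].

Lemma size_column_values n (a : 'cV[R]_n) : size (column_values a) = n.
Proof. by rewrite size_map size_enum_ord. Qed.

Lemma nth_column_values n (a : 'cV[R]_n) (j : 'I_n) : (column_values a)`_j = a j 0.
Proof. by rewrite (nth_map j) ?size_enum_ord// nth_ord_enum. Qed.

Lemma achieves_solve l b s (v : 'cV[R]_(N l)) : stores s b (column_values v) ->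
  achieves (solve N l b) s (tsolve l)
    (fun a s' => stores s' a (column_values (solver v))).
Proof.
move=> sb; apply: (achieves_append (v := column_values (solver v))) => [k|].
  rewrite /solve /= size_column_values.
  have -> // : \col_(k < N l) read s b k = v.
  apply/colP => j; rewrite mxE /read (stores_nth1 sb) ?size_column_values//.
  exact: nth_column_values.
by have := stores_new s (column_values (solver v)); rewrite size_column_values.
Qed.

Lemma achieves_differ i j s u w : stores s [:: i] [:: u] ->
  stores s [:: j] [:: w] ->
  achieves (differ i j) s 2 (fun b s' => s' = s /\ b = (u != w)).
Proof.
move=> [_ [<-]] [_ [<-]]; rewrite /achieves.
case: (ltgtP s`_i s`_j) => ij.
- exists true, [::], 1%N; rewrite cats0; split=> // k.
  by rewrite /differ /= ij.
- exists true, [::], 2%N; rewrite cats0; split=> // k.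
  by rewrite /differ /= ij (lt_gtF ij) /= addnA.
- exists false, [::], 2%N; rewrite cats0; split=> // k.
  by rewrite /differ /= ij ltxx /= addnA.
Qed.

(** Each call runs on an extension of the initial memory, and its result must survive
    the extensions made by the later calls. *)
Lemma achieves_foreach (A : eqType) B (f : A -> builder B) (l : seq A) s
    (t : A -> nat) (Q : A -> B -> seq R -> Prop) :
  (forall x b s e, Q x b s -> Q x b (s ++ e)) ->
  (forall x e, x \in l -> achieves (f x) (s ++ e) (t x) (Q x)) ->
  achieves (foreach f l) s (\sum_(x <- l) t x)
    (fun bs s' => List.Forall2 (fun x b => Q x b s') l bs).
Proof.
move=> Qmono; elim: l s => [|x l IH] s fQ /=.
  by rewrite big_nil; apply: achieves_ret.
rewrite big_cons; apply: (achieves_bind (Q := Q x)).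
  by have := fQ x [::]; rewrite cats0; apply; rewrite mem_head.
move=> b e Qb; rewrite -[X in achieves _ _ X]addn0; apply: achieves_bind.
  by apply: IH => y e' yl; rewrite -catA; apply: fQ; rewrite inE yl orbT.
move=> bs e' Qbs; apply: achieves_ret; apply: List.Forall2_cons => //.
exact: Qmono.
Qed.

Lemma achieves_loop (A S : Type) (f : A -> S -> builder S) (t : A -> nat)
    (I : seq A -> S -> seq R -> Prop) (l : seq A) st s :
  (forall past x future st e, l = past ++ x :: future -> I past st (s ++ e) ->
    achieves (f x st) (s ++ e) (t x) (I (rcons past x))) ->
  I [::] st s -> achieves (loop f l st) s (\sum_(x <- l) t x) (I l).
Proof.
move=> step I0; pose past : seq A := [::].
rewrite -[l in I l]/(past ++ l); rewrite -[[::]]/past in I0.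
have : forall p x future st e, l = p ++ x :: future ->
    I (past ++ p) st (s ++ e) ->
    achieves (f x st) (s ++ e) (t x) (I (past ++ rcons p x)) by [].
(* Generalising over the processed part makes the induction go through. *)
move: past st s I0 {step} => past; elim: l past => [|x l IH] past st s I0 step /=.
  by rewrite big_nil cats0; apply: achieves_ret.
rewrite big_cons; apply: achieves_bind.
  have := step [::] x l st [::] erefl; rewrite !cats0.
  by move=> /(_ I0); exact.
move=> st' e /= I1; rewrite cats1 in I1; rewrite -cat_rcons.
apply: IH => // p y future st2 e' lE; rewrite !cat_rcons -!catA => I2.
have := step (x :: p) y future st2 (e ++ e').
by rewrite lE /=; apply.
Qed.

Lemma run_output m s t (v : seq R) :
  achieves m s t (fun l s' => stores s' l v) ->
  (run (output m (size s)) s).2 = v /\ ((run (output m (size s)) s).1 <= t)%N.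
Proof.
by move=> [l [e [u [ut [_ lv] mE]]]]; rewrite /output mE /= lv addn0.
Qed.

End Semantics.
End Builders.

(** * Sparse kernel sums *)

Section Subroutines.
Context {R : realType} {d : nat}.
Variables (Phi : 'rV[R]_d -> R) (N : nat -> nat).
Variables (solver : forall l, 'cV[R]_(N l) -> 'cV[R]_(N l)) (tsolve : nat -> nat).
Variables (delta : nat -> R) (x : nat -> 'rV[R]_d).

Local Notation K := (scaled_kernel Phi delta).
Local Notation achieves := (achieves Phi solver tsolve).

(** The factor [delta ^ - d] is applied by [d] divisions. *)
Definition kernel_value (p q : seq nat) (r : nat) : builder (R := R) nat :=
  bind (foreach (fun k : 'I_d => bind (op Defs.Sub (nth 0%N p k) (nth 0%N q k))
                                      (fun t => op Div t r)) (enum 'I_d))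
    (fun u => bind (phi u) (loop (fun _ w => op Div w r) (enum 'I_d))).

Lemma achieves_kernel_value p q r s l (y z : 'rV[R]_d) :
  stores s p (coords y) -> stores s q (coords z) -> stores s [:: r] [:: delta l] ->
  achieves (kernel_value p q r) s (3 * d + 1)
    (fun a s' => stores s' [:: a] [:: K l (y - z)]).
Proof.
move=> sp sq sr; pose u := (delta l)^-1 *: (y - z).
have -> : (3 * d + 1 = \sum_(k <- enum 'I_d) (1 + 1) +
                       (1 + \sum_(k <- enum 'I_d) 1))%N.
  by rewrite !big_enum /= !sum_nat_const card_ord; lia.
apply: achieves_bind.
  apply: (achieves_foreach (Q := fun k a s' => stores s' [:: a] [:: u 0 k])).
    by move=> k b s' e; exact: stores_cat.
  move=> k e _; apply: achieves_bind.
    apply: achieves_op; apply: stores_cat.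
      by apply: stores_nth sp _; rewrite size_coords.
    by apply: stores_nth sq _; rewrite size_coords.
  move=> a e' /= sa.
  have -> : u 0 k = arith_op Div (y 0 k - z 0 k) (delta l) by rewrite !mxE mulrC.
  apply: achieves_op; last exact/stores_cat/stores_cat.
  by rewrite !nth_coords in sa.
move=> b e /stores_map; rewrite -/(coords u) => sb; apply: achieves_bind.
  exact: achieves_phi sb.
move=> a e' sa.
apply: achieves_weaken (leqnn _) _ (achieves_loop
  (I := fun past w s' => stores s' [:: w] [:: Phi u / delta l ^+ size past]) _ _).
- by move=> w e2; rewrite size_enum_ord [_ / _]mulrC.
- move=> past k future w e2 _ sw; rewrite size_rcons exprSr invfM mulrA.
  rewrite -[_ * _ in X in achieves _ _ _ X]/(arith_op Div _ _).
  by apply: achieves_op => //; do 3!apply: stores_cat.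
- by rewrite expr0 divr1.
Qed.

Definition neighbours (z : nat) (p : seq nat) (q : nat -> seq nat) (l : nat) :
    builder (R := R) (seq (nat * nat)) :=
  bind (foreach (fun j => bind (kernel_value p (q j) l.-1) (fun a =>
          bind (differ a z) (fun b => ret (if b then [:: (j, a)] else [::]))))
        (iota 0 (N l)))
    (fun ls => ret (flatten ls)).

(** The list names exactly the points with a nonzero kernel value; this is what
    bounds its length and what allows the other points to be left out of sums. *)
Definition lists_neighbours (y : 'rV[R]_d) l (ns : seq (nat * nat)) (s : seq R) :=
  unzip1 ns = [seq j <- iota 0 (N l) | K l (y - x j) != 0] /\
  stores s (unzip2 ns) [seq K l (y - x j) | j <- unzip1 ns].

Lemma lists_neighbours_cat y l ns s e :
  lists_neighbours y l ns s -> lists_neighbours y l ns (s ++ e).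
Proof. by move=> [? ?]; split=> //; exact: stores_cat. Qed.

Lemma achieves_neighbours z p q l s y :
  stores s [:: z] [:: 0] -> stores s p (coords y) ->
  (forall j, (j < N l)%N -> stores s (q j) (coords (x j))) ->
  ((0 < N l)%N -> stores s [:: l.-1] [:: delta l]) ->
  achieves (neighbours z p q l) s (N l * (3 * d + 3)) (lists_neighbours y l).
Proof.
move=> sz sp sq sr.
pose Q j ns s' := unzip1 ns = [seq i <- [:: j] | K l (y - x i) != 0] /\
  stores s' (unzip2 ns) [seq K l (y - x i) | i <- unzip1 ns].
have -> : (N l * (3 * d + 3) = \sum_(j <- iota 0 (N l)) (3 * d + 1 + (2 + 0)) + 0)%N.
  by rewrite big_const_seq count_predT size_iota iter_addn_0 mulnC; lia.
apply: achieves_bind.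
  apply: (achieves_foreach (Q := Q)).
    by move=> j ns s' e [? ?]; split=> //; exact: stores_cat.
  move=> j e; rewrite mem_iota add0n => /= jl; apply: achieves_bind.
    apply: (@achieves_kernel_value _ _ _ _ l y (x j)); apply: stores_cat => //.
      exact: sq.
    by apply: sr; case: (N l) jl.
  move=> a e' sa; apply: achieves_bind.
    by apply: (achieves_differ Phi solver tsolve (w := 0) sa); do 2!apply: stores_cat.
  move=> b e2 [-> ->]; apply: achieves_ret; rewrite /Q /=.
  by case: ifP.
move=> ls e H; apply: achieves_ret; rewrite /lists_neighbours.
elim: H => {ls sz sp sq sr} [|j ns js ls].
  by split.
move=> [h1 h2] _ [ih1 ih2]; split.
  by rewrite [flatten _]/= /unzip1 map_cat -/unzip1 h1 ih1 -filter_cat.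
rewrite [flatten _]/= /unzip1 /unzip2 !map_cat -/unzip1 -/unzip2.
exact: stores_append.
Qed.

Definition dot (z : nat) (prs : seq (nat * nat)) : builder (R := R) nat :=
  loop (fun pr acc => bind (op Mul pr.1 pr.2) (op Add acc)) prs z.

Lemma achieves_dot z prs s : stores s [:: z] [:: 0] ->
  (forall pr, pr \in prs -> (pr.1 < size s) && (pr.2 < size s))%N ->
  achieves (dot z prs) s (2 * size prs)
    (fun a s' => stores s' [:: a] [:: \sum_(pr <- prs) s`_pr.1 * s`_pr.2]).
Proof.
move=> sz inb.
have -> : (2 * size prs = \sum_(pr <- prs) (1 + 1))%N.
  by rewrite big_const_seq count_predT iter_addn_0.
apply: (achieves_loop (I := fun past a s' =>
   stores s' [:: a] [:: \sum_(pr <- past) s`_pr.1 * s`_pr.2])); last first.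
  by rewrite big_nil.
move=> past pr future acc e prsE sacc; apply: achieves_bind.
  have /andP[i1 i2] : (pr.1 < size s)%N && (pr.2 < size s)%N.
    by apply: inb; rewrite prsE mem_cat mem_head orbT.
  by apply: (@achieves_op _ _ _ _ _ _ _ _ _ _ s`_pr.1 s`_pr.2);
    apply: stores_cat; split; rewrite //= ?i1 ?i2.
move=> a e' sa; rewrite big_rcons; apply: achieves_op => //.
exact: stores_cat.
Qed.

(** The address pairs whose products add up to the sum, over the levels in [ls], of
    the expansions with coefficients stored at [blk l], for neighbours [ns l]. *)
Definition coef_pairs (ls : seq nat) (blk : nat -> seq nat)
    (ns : nat -> seq (nat * nat)) : seq (nat * nat) :=
  flatten [seq [seq (nth 0%N (blk l) r.1, r.2) | r <- ns l] | l <- ls].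

(** The points missing from the neighbour lists contribute zero, so the short sums
    over the lists are full expansions. *)
Lemma achieves_expansions z ls blk ns s y (a : forall l, 'cV[R]_(N l)) B :
  stores s [:: z] [:: 0] ->
  (forall l, l \in ls -> stores s (blk l) (column_values (a l))) ->
  (forall l, l \in ls -> lists_neighbours y l (ns l) s) ->
  (forall l, l \in ls -> (size (ns l) <= B)%N) ->
  achieves (dot z (coef_pairs ls blk ns)) s (2 * (B * size ls))
    (fun w s' => stores s' [:: w]
       [:: \sum_(l <- ls) expansion Phi delta x (a l) y]).
Proof.
move=> sz sblk sns nsB.
have bound l r : l \in ls -> r \in ns l -> (r.1 < N l)%N.
  move=> lls rns; have [e1 _] := sns l lls.
  have : r.1 \in unzip1 (ns l) by apply: map_f.
  by rewrite e1 mem_filter mem_iota => /andP[_].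
have sizeB : (size (coef_pairs ls blk ns) <= B * size ls)%N.
  rewrite /coef_pairs; elim: (ls) nsB => [|l ls' IH] nsB //=.
  rewrite size_cat size_map mulnS leq_add ?nsB ?mem_head// IH// => m mls.
  by rewrite nsB// inE mls orbT.
apply: achieves_weaken (achieves_dot sz _) => [|w e|pr].
- by rewrite leq_mul2l sizeB.
- have -> : \sum_(pr <- coef_pairs ls blk ns) s`_pr.1 * s`_pr.2
             = \sum_(l <- ls) expansion Phi delta x (a l) y; last by [].
  rewrite /coef_pairs big_flatten big_map big_seq [RHS]big_seq; apply: eq_bigr => l lls.
  have [e1 [_ e2]] := sns l lls.
  transitivity (\sum_(j <- unzip1 (ns l))
                  (column_values (a l))`_j * K l (y - x j)).
    rewrite !big_map big_seq [RHS]big_seq; apply: eq_bigr => r rns.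
    rewrite (stores_nth1 (sblk l lls)) ?size_column_values ?bound//=.
    by congr (_ * _); move: e2; rewrite -!map_comp => /eq_in_map; apply.
  rewrite e1 big_filter big_mkcond /= -[X in iota 0 X]subn0 big_mkord.
  apply: eq_bigr => j _; rewrite nth_column_values.
  by case: eqP => // ->; rewrite mulr0.
- move=> /flattenP[_ /mapP[l lls ->] /mapP[r rns ->]] /=.
  have [[in1 _] [_ [in2 _]]] := (sblk l lls, sns l lls).
  rewrite (allP in1) ?(allP in2)//; first exact: map_f.
  by rewrite mem_nth// (stores_size (sblk l lls)) size_column_values bound.
Qed.

End Subroutines.

(** * Levels of the points *)

Lemma iota_split a n p m (f : seq nat) :
  iota a n = p ++ m :: f -> m = (a + size p)%N /\ p = iota a (m - a).
Proof.
move=> e; have pn : (size p < n)%N.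
  by rewrite -(size_iota a n) e size_cat /= addnS ltnS leq_addr.
have -> : m = (a + size p)%N by rewrite -(nth_iota 0 a pn) e nth_cat ltnn subnn.
split=> //; rewrite addKn -{1}(take_size_cat (m :: f) (erefl (size p))) -e.
by rewrite take_iota; congr iota; apply/minn_idPl/ltnW.
Qed.

Lemma flatten_map_flatten (T : Type) (sss : seq (seq (seq T))) :
  flatten [seq flatten ss | ss <- sss] = flatten (flatten sss).
Proof. by elim: sss => //= ss sss ->; rewrite flatten_cat. Qed.

Lemma stores_part (R : realType) (pre v post : seq R) :
  stores (pre ++ v ++ post) (iota (size pre) (size v)) v.
Proof. by rewrite catA; apply/stores_cat/stores_new. Qed.

Lemma sum_zip_stores (R : realType) (s : seq R) l l' u w :
  stores s l u -> stores s l' w -> size u = size w ->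
  \sum_(pr <- zip l l') s`_pr.1 * s`_pr.2 = \sum_(k < size u) u`_k * w`_k.
Proof.
move=> su sw uw; have ll' : size l = size l'.
  by rewrite (stores_size su) (stores_size sw).
rewrite (big_nth (0, 0)%N) big_mkord size_zip -ll' minnn (stores_size su).
apply: eq_bigr => k _; rewrite nth_zip//= (stores_nth1 su)//.
by rewrite (stores_nth1 sw) -?uw.
Qed.

Section LevelOf.
Variables (L : nat) (N : nat -> nat).
Hypothesis levN : level_sizes L N.

Definition level_of (i : nat) : nat := find (fun l => i < N l)%N (iota 0 L.+1).

Lemma level_ofP i : (i < N L)%N ->
  [/\ (0 < level_of i <= L)%N, (i < N (level_of i))%N &
      forall l, (l < level_of i)%N -> (N l <= i)%N].
Proof.
move=> iL; have [_ N0 _] := levN.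
have has_i : has (fun l => i < N l)%N (iota 0 L.+1).
  by apply/hasP; exists L => //; rewrite mem_iota ltnS leqnn.
have lt_lev : (level_of i < L.+1)%N.
  by rewrite -[X in (_ < X)%N](size_iota 0) -has_find.
have ilev : (i < N (level_of i))%N.
  by have := nth_find 0%N has_i; rewrite nth_iota.
split=> //.
  by apply/andP; split; [case: (level_of i) ilev => //; rewrite N0|exact: lt_lev].
move=> l ll; have := before_find 0%N ll; rewrite nth_iota; last exact: ltn_trans lt_lev.
by rewrite add0n => /negbT; rewrite -leqNgt.
Qed.

Lemma level_of_eq i l : (l < L)%N -> (N l <= i < N l.+1)%N -> level_of i = l.+1.
Proof.
move=> lL /andP[li iSl].
have [|l1 i1 below] := @level_ofP i.
  by apply: leq_trans iSl (level_sizes_le levN _); rewrite lL leqnn.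
apply/eqP; rewrite eqn_leq; apply/andP; split; rewrite leqNgt; apply/negP => H.
  by have := below _ H; rewrite leqNgt iSl.
have : (N (level_of i) <= N l)%N by apply: (level_sizes_le levN); rewrite -ltnS H ltnW.
by rewrite leqNgt (leq_ltn_trans li).
Qed.

(** Enumerating the points by levels is enumerating them all, since the sets are
    nested; this removes the outer loop from [necessary_coefs]. *)
Lemma flatten_by_level (T : Type) (F : nat -> nat -> seq T) :
  flatten [seq flatten [seq F i l | i <- index_iota (N l.-1) (N l)]
          | l <- index_iota 1 L.+1]
  = flatten [seq F i (level_of i) | i <- iota 0 (N L)].
Proof.
have [_ N0 mono] := levN.
suff H k : (k <= L)%N ->
  flatten [seq flatten [seq F i l | i <- index_iota (N l.-1) (N l)]
          | l <- index_iota 1 k.+1]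
  = flatten [seq F i (level_of i) | i <- iota 0 (N k)] by exact: H.
elim: k => [|k IH] kL; first by rewrite N0.
have -> : index_iota 1 k.+2 = index_iota 1 k.+1 ++ [:: k.+1].
  by rewrite /index_iota !subn1 -[k.+2.-1](addn1 k) iotaD.
rewrite map_cat flatten_cat (IH (ltnW kL)) /= cats0 /index_iota.
rewrite -[X in _ = flatten [seq _ | i <- iota 0 X]](subnKC (mono k kL)).
rewrite iotaD map_cat flatten_cat add0n /=; congr (_ ++ flatten _).
apply/eq_in_map => i; rewrite mem_iota subnKC ?mono// => ik.
by rewrite (level_of_eq kL ik).
Qed.

Lemma sum_from_level (V : zmodType) i m (F : nat -> V) :
  (0 < level_of i <= m)%N -> (forall l, (0 < l < level_of i)%N -> F l = 0) ->
  \sum_(1 <= l < m) F l = \sum_(l <- index_iota (level_of i) m) F l.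
Proof.
move=> /andP[l0 lm] F0; rewrite (big_cat_nat _ lm)//=.
by rewrite big_nat big1 ?add0r.
Qed.

End LevelOf.

(** * The two programs *)

Section Programs.
Context {R : realType} (d L : nat) (N : nat -> nat).

Local Notation builder := (builder (R := R)).

Definition point_addresses (j : nat) : seq nat :=
  nth [::] (reshape (nseq (N L) d) (iota L (N L * d))) j.

(** Level 0, which has no points, is included so that the lists are indexed by the
    level itself. *)
Definition neighbour_table (z : nat) (p : seq nat) :
    builder (seq (seq (nat * nat))) :=
  foreach (neighbours (d := d) N z p point_addresses) (iota 0 L.+1).

Definition necessary_levels i := index_iota (level_of L N i) L.+1.

(** Forward substitution for the point of index [i]; [o] and [z] are the addresses
    of 1 and 0 and [tab] holds the neighbours of all points.  The levels below
    that of the point are represented by empty blocks, which again makes the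
    level the index and leaves the output unchanged. *)
Definition column (z o : nat) (tab : seq (seq (seq (nat * nat)))) (i : nat) :
    builder (seq nat) :=
  bind (loop (fun m blks =>
      bind (foreach (fun k =>
          bind (dot z (coef_pairs (index_iota (level_of L N i) m)
                                  (nth [::] blks) (nth [::] (nth [::] tab k))))
               (op Defs.Sub (if i == k then o else z)))
        (iota 0 (N m)))
      (fun b => bind (solve N m b) (fun blk => ret (rcons blks blk))))
    (necessary_levels i) (nseq (level_of L N i) [::]))
  (fun blks => ret (flatten blks)).

Definition coef_program : program R :=
  output (bind (const 0) (fun z => bind (const 1) (fun o =>
    bind (foreach (fun k => neighbour_table z (point_addresses k)) (iota 0 (N L)))
      (fun tab => bind (foreach (column z o tab) (iota 0 (N L)))
        (fun cols => ret (flatten cols)))))) (L + N L * d).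

(** The blocks, as pairs of a point and a level, in the order in which they are
    stored. *)
Definition necessary_keys : seq (nat * nat) :=
  [seq (i, m) | i <- iota 0 (N L), m <- necessary_levels i].

Definition block_sizes : seq nat := [seq N p.2 | p <- necessary_keys].

Definition block_addresses (i m : nat) : seq nat :=
  nth [::] (reshape block_sizes (iota (L + N L * d) (sumn block_sizes)))
      (index (i, m) necessary_keys).

(** The memory consists of the scaling parameters, the points, the coefficients, the
    values of [f] (from address [v]) and the coordinates of the evaluation point. *)
Definition eval_program : program R :=
  let v := (L + N L * d + sumn block_sizes)%N in
  output (bind (const 0) (fun z =>
    bind (neighbour_table z (iota (v + N L) d)) (fun tab =>
    bind (foreach (fun i => dot z (coef_pairs (necessary_levels i)
                                   (block_addresses i) (nth [::] tab)))
            (iota 0 (N L))) (fun bs =>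
    bind (dot z (zip (iota v (N L)) bs)) (fun a => ret (a :: bs))))))
  (v + N L + d).

Lemma no_solve_dot z prs : no_solve (dot (R := R) z prs).
Proof. by apply: no_solve_loop => pr acc n k kS; exact: kS. Qed.

Lemma eval_program_solve_free : solve_free eval_program.
Proof.
suff : no_solve (bind (const (R := R) 0) (fun z =>
    bind (neighbour_table z (iota (L + N L * d + sumn block_sizes + N L) d)) (fun tab =>
    bind (foreach (fun i => dot z (coef_pairs (necessary_levels i)
                                   (block_addresses i) (nth [::] tab)))
            (iota 0 (N L))) (fun bs =>
    bind (dot z (zip (iota (L + N L * d + sumn block_sizes) (N L)) bs))
      (fun a => ret (a :: bs)))))) by apply.
apply: no_solve_bind => [n k kS|z]; first exact: kS.
apply: no_solve_bind => [|tab].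
  apply: no_solve_foreach => l; apply: no_solve_bind => [|ls n k kS]; last exact: kS.
  apply: no_solve_foreach => j; apply: no_solve_bind => [|a].
    apply: no_solve_bind => [|u].
      apply: no_solve_foreach => k.
      by apply: no_solve_bind => [|t] n k' kS; exact: kS.
    apply: no_solve_bind => [n k kS|w]; first exact: kS.
    by apply: no_solve_loop => a st n k kS; exact: kS.
  apply: no_solve_bind => [n k kS|b n k kS]; last exact: kS.
  by rewrite /= !kS.
apply: no_solve_bind => [|bs].
  by apply: no_solve_foreach => i; exact: no_solve_dot.
by apply: no_solve_bind => [|a n k kS]; [exact: no_solve_dot|exact: kS].
Qed.

End Programs.

(** * Correctness and operation counts of the programs *)

Section Correctness.
Context {R : realType} {d : nat}.
Variables (Phi : 'rV[R]_d -> R) (L : nat) (N : nat -> nat).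
Variables (solver : forall l, 'cV[R]_(N l) -> 'cV[R]_(N l)) (tsolve : nat -> nat).
Variables (delta : nat -> R) (x : nat -> 'rV[R]_d) (B : nat).
Hypothesis levN : level_sizes L N.
Hypothesis solverP : forall l, (0 < l <= L)%N ->
  forall b, interp_mx Phi delta N x l *m solver b = b.
Hypothesis fewB : forall l y, (0 < l <= L)%N ->
  (count (fun j => scaled_kernel Phi delta l (y - x j) != 0%R) (iota 0 (N l))
   <= B)%N.

Local Notation achieves := (achieves Phi solver tsolve).
Local Notation lists_neighbours := (lists_neighbours Phi N delta x).
Local Notation coef := (ml_coef Phi delta x L solver).
Local Notation expansion := (expansion Phi delta x).
Local Notation lev := (level_of L N).

Let N_le l : (l <= L)%N -> (N l <= N L)%N.
Proof. by move=> lL; apply: (level_sizes_le levN); rewrite lL leqnn. Qed.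

Definition stores_geometry (s : seq R) : Prop :=
  (forall l, (0 < l <= L)%N -> stores s [:: l.-1] [:: delta l]) /\
  (forall j, (j < N L)%N -> stores s (point_addresses d L N j) (coords (x j))).

Lemma stores_geometry_cat s e : stores_geometry s -> stores_geometry (s ++ e).
Proof. by move=> [gd gx]; split=> [l lL|j jL]; apply: stores_cat; auto. Qed.

Lemma size_geometry_input : size (geometry_input delta x L (N L)) = (L + N L * d)%N.
Proof.
rewrite size_cat size_map size_iota subn1; congr addn.
rewrite size_flatten /shape -map_comp sumnE big_map.
rewrite (eq_bigr (fun=> d)) => [|i _]; last exact: size_coords.
by rewrite big_const_seq count_predT size_iota iter_addn_0 mulnC.
Qed.

Lemma geometry_input_stored : stores_geometry (geometry_input delta x L (N L)).
Proof.
split=> [l /andP[l0 lL]|j jL].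
  have sL : size (index_iota 1 L.+1) = L by rewrite size_iota subn1.
  have := stores_part [::] [seq delta k | k <- index_iota 1 L.+1]
            (flatten [seq coords (x i) | i <- iota 0 (N L)]).
  rewrite cat0s size_map sL => /stores_nth => /(_ l.-1).
  rewrite size_map sL nth_iota ?(nth_map 0%N) ?sL ?prednK//.
  by rewrite nth_iota ?subn1 ?prednK// add1n prednK//; exact.
have sh : shape [seq coords (x i) | i <- iota 0 (N L)] = nseq (N L) d.
  apply: (@eq_from_nth _ 0%N) => [|i]; rewrite !size_map size_iota ?size_nseq//.
  move=> iL; rewrite nth_nseq iL (nth_map [::]) ?size_map ?size_iota//.
  by rewrite (nth_map 0%N) ?size_iota// size_coords.
have := stores_part [seq delta k | k <- index_iota 1 L.+1]
          (flatten [seq coords (x i) | i <- iota 0 (N L)]) [::].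
rewrite cats0 size_map size_iota subn1 size_flatten sh sumn_nseq mulnC.
move=> /stores_block => /(_ j); rewrite sh /point_addresses.
by rewrite (nth_map 0%N) ?size_iota// nth_iota.
Qed.

Lemma achieves_neighbour_table z p s y : stores s [:: z] [:: 0] ->
  stores s p (coords y) -> stores_geometry s ->
  achieves (neighbour_table d L N z p) s ((3 * d + 3) * \sum_(1 <= l < L.+1) N l)
    (fun tab s' => forall l, (l <= L)%N -> lists_neighbours y l (nth [::] tab l) s').
Proof.
move=> sz sp [gd gx].
have -> : ((3 * d + 3) * \sum_(1 <= l < L.+1) N l =
           \sum_(l <- iota 0 L.+1) N l * (3 * d + 3))%N.
  rewrite -big_distrl /= mulnC; congr muln.
  by have [_ N0 _] := levN; rewrite /index_iota subn1 big_cons N0.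
apply: achieves_weaken (leqnn _) _ (achieves_foreach
   (Q := fun l ns s' => lists_neighbours y l ns s') _ _).
- move=> tab e tabP l lL; have := Forall2_nth 0%N [::] tabP (n := l).
  by rewrite size_iota nth_iota ?ltnS//; apply.
- by move=> l ns s' e; exact: lists_neighbours_cat.
move=> l e; rewrite mem_iota add0n ltnS => /= lL.
apply: achieves_neighbours; [exact: stores_cat|exact: stores_cat| |].
  by move=> j jl; apply/stores_cat/gx/(leq_trans jl)/N_le.
move=> Nl; apply/stores_cat/gd; rewrite lL andbT.
by have [_ N0 _] := levN; case: (l) Nl => //; rewrite N0.
Qed.

Lemma size_neighbours l y ns s : (0 < l <= L)%N ->
  lists_neighbours y l ns s -> (size ns <= B)%N.
Proof.
move=> lL [e _]; rewrite -(size_map (@fst _ _)) -/(unzip1 _) e size_filter.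
exact: fewB.
Qed.

Lemma achieves_level_sum z ls blk tab s y (a : forall l, 'cV[R]_(N l)) :
  stores s [:: z] [:: 0] -> (size ls <= L)%N ->
  (forall l, l \in ls -> (0 < l <= L)%N) ->
  (forall l, l \in ls -> stores s (blk l) (column_values (a l))) ->
  (forall l, (l <= L)%N -> lists_neighbours y l (nth [::] tab l) s) ->
  achieves (dot z (coef_pairs ls blk (nth [::] tab))) s (2 * (B * L))
    (fun w s' => stores s' [:: w] [:: \sum_(l <- ls) expansion (a l) y]).
Proof.
move=> sz lsL lsP sblk tabP.
apply: achieves_weaken _ (fun _ _ => id)
  (achieves_expansions solver tsolve (B := B) sz sblk _ _).
- by rewrite leq_mul2l /= leq_mul2l lsL orbT.
- by move=> l /lsP/andP[_]; exact: tabP.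
- move=> l /lsP lL; apply: (size_neighbours lL (tabP _ _)).
  by case/andP: lL.
Qed.

Lemma mem_levels i m l : (i < N L)%N -> (m <= L.+1)%N ->
  l \in index_iota (lev i) m -> (0 < l <= L)%N.
Proof.
move=> iL mL; have [/andP[i0 _] _ _] := level_ofP levN iL.
rewrite mem_index_iota => /andP[il lm].
by rewrite (leq_trans i0)//= -ltnS (leq_trans lm).
Qed.

Lemma size_levels i m : (i < N L)%N -> (m <= L.+1)%N ->
  (size (index_iota (lev i) m) <= L)%N.
Proof.
move=> iL mL; have [/andP[i0 _] _ _] := level_ofP levN iL.
by rewrite size_iota; lia.
Qed.

(** The blocks below the level of the point vanish. *)
Lemma expansion_sum_from_level i m y : (i < N L)%N -> (lev i <= m)%N ->
  \sum_(1 <= l < m) expansion (coef i l) y =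
  \sum_(l <- index_iota (lev i) m) expansion (coef i l) y.
Proof.
move=> iL im; have [/andP[i0 iL'] _ below] := level_ofP levN iL.
apply: sum_from_level; first by rewrite i0.
move=> l /andP[l0 li]; rewrite /expansion (ml_coef_eq0 levN solverP)//; last exact: below.
  by rewrite big1// => j _; rewrite mxE mul0r.
by rewrite l0 (leq_trans (ltnW li)).
Qed.

(** The right-hand side assembled from the levels since that of the point is the full
    one, because the earlier blocks are zero. *)
Lemma coef_column i m (f : nat -> R) : (i < N L)%N -> (lev i <= m <= L)%N ->
  (forall k, (k < N m)%N -> f k = (i == k)%:R -
     \sum_(l <- index_iota (lev i) m) expansion (coef i l) (x k)) ->
  exists2 v : 'cV_(N m), column_values v = [seq f k | k <- iota 0 (N m)]
                        & solver v = coef i m.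
Proof.
move=> iL /andP[im mL] fE; exists (\col_k f k).
  rewrite /column_values -val_enum_ord -map_comp.
  by apply/eq_map => k; rewrite /= mxE.
rewrite [RHS]ml_coefE; congr solver; apply/colP => k.
rewrite !mxE fE// (lagrange_node levN solverP)//;
  last by apply: leq_trans (ltn_ord k) (N_le mL).
congr (_ - _); rewrite -expansion_sum_from_level// summxE.
by apply: eq_bigr => l _; rewrite expansion_node.
Qed.

Definition stored_column i : seq R :=
  flatten [seq column_values (coef i m) | m <- necessary_levels L N i].

(** In the loop invariant the finished blocks are stored twice over: each at its
    level, for the later sums, and concatenated, for the output. *)
Lemma achieves_column z o tab i s : (i < N L)%N ->
  stores s [:: z] [:: 0] -> stores s [:: o] [:: 1] ->
  (forall k l, (k < N L)%N -> (l <= L)%N ->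
     lists_neighbours (x k) l (nth [::] (nth [::] tab k) l) s) ->
  achieves (column L N z o tab i) s
    (\sum_(1 <= m < L.+1) (N m * (2 * (B * L) + 1) + tsolve m))
    (fun a s' => stores s' a (stored_column i)).
Proof.
move=> iL sz so tabP; have [/andP[i0 levL] _ _] := level_ofP levN iL.
pose I past blks s' := [/\ size blks = (lev i + size past)%N,
  stores s' (flatten blks) (flatten [seq column_values (coef i m) | m <- past]) &
  forall m, m \in past -> stores s' (nth [::] blks m) (column_values (coef i m))].
have -> : forall t : nat -> nat, (\sum_(1 <= m < L.+1) t m =
  \sum_(1 <= m < lev i) t m + (\sum_(m <- necessary_levels L N i) t m + 0))%N.
  by move=> t; rewrite addn0 (big_cat_nat _ (n := lev i))//= ltnW.
apply: achieves_weaken (leq_addl _ _) (fun _ _ => id) _.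
apply: achieves_bind.
  apply: (achieves_loop (I := I)
     (t := fun m => (N m * (2 * (B * L) + 1) + tsolve m)%N)); last first.
    split=> //; first by rewrite size_nseq addn0.
    by rewrite (_ : flatten _ = [::]); [split|elim: (lev i)].
  move=> past m future blks e levE [szb sflat sblk].
  have [mE pastE] := iota_split levE.
  have mP : (lev i <= m <= L)%N.
    have : m \in necessary_levels L N i by rewrite levE mem_cat mem_head orbT.
    by rewrite mem_index_iota ltnS.
  have [im mL] := andP mP.
  have pastI : past = index_iota (lev i) m by [].
  pose f k : R := (i == k)%:R -
    \sum_(l <- index_iota (lev i) m) expansion (coef i l) (x k).
  apply: (achieves_bind (t' := tsolve m)).
    have -> : (N m * (2 * (B * L) + 1) =
               \sum_(k <- iota 0 (N m)) (2 * (B * L) + 1))%N.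
      by rewrite big_const_seq count_predT size_iota iter_addn_0 mulnC.
    apply: (achieves_foreach (Q := fun k a s' => stores s' [:: a] [:: f k])).
      by move=> k b s' e'; exact: stores_cat.
    move=> k e'; rewrite mem_iota add0n => /= km; apply: achieves_bind.
      apply: (achieves_level_sum (y := x k) (a := coef i)).
      - by do 2!apply: stores_cat.
      - by apply: size_levels => //; exact: leqW.
      - by move=> l; apply: mem_levels => //; exact: leqW.
      - by move=> l; rewrite -pastI => /sblk; exact: stores_cat.
      - move=> l lL; do 2!apply: lists_neighbours_cat; apply: tabP => //.
        exact: leq_trans km (N_le mL).
    move=> w e2 sw; apply: (achieves_op Phi solver tsolve Defs.Sub (u := (i == k)%:R)) => //.
    by case: eqP => _; do 3!apply: stores_cat.
  move=> b e' /stores_map sb.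
  have [v vE sv] := coef_column iL mP (fun k _ => erefl (f k)).
  rewrite -vE in sb; rewrite -[tsolve m]addn0; apply: achieves_bind.
    exact: achieves_solve sb.
  move=> blk e2; rewrite sv => sblk'; apply: achieves_ret.
  split; first by rewrite !size_rcons szb addnS.
    rewrite map_rcons !flatten_rcons; apply: stores_append => //.
    by do 2!apply: stores_cat.
  move=> l; rewrite mem_rcons inE nth_rcons szb -mE.
  case: eqP => [->|_ /= lp]; first by rewrite ltnn ?eqxx.
  have -> : (l < m)%N by move: lp; rewrite pastI mem_index_iota => /andP[].
  by do 2!apply: stores_cat; exact: sblk.
move=> blks e [_ sflat _]; exact: achieves_ret.
Qed.

Lemma necessary_coefsE :
  necessary_coefs L coef = flatten [seq stored_column i | i <- iota 0 (N L)].
Proof.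
exact: (flatten_by_level levN (fun i l =>
  flatten [seq column_values (coef i m) | m <- index_iota l L.+1])).
Qed.

Lemma coef_program_correct (M := (\sum_(1 <= l < L.+1) N l)%N) :
  let r := run Phi solver tsolve (coef_program d L N)
             (geometry_input delta x L (N L)) in
  r.2 = necessary_coefs L coef /\
  (r.1 <= 2 + N L * ((3 * d + 3) * M) +
     N L * \sum_(1 <= m < L.+1) (N m * (2 * (B * L) + 1) + tsolve m))%N.
Proof.
rewrite /coef_program -size_geometry_input; apply: run_output.
have geo := geometry_input_stored.
set T1 := ((3 * d + 3) * M)%N; set T2 := (\sum_(1 <= m < L.+1) _)%N.
have -> : (2 + N L * T1 + N L * T2 =
   1 + (1 + (\sum_(k <- iota 0 (N L)) T1 + (\sum_(i <- iota 0 (N L)) T2 + 0))))%N.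
  by rewrite !big_const_seq !count_predT size_iota !iter_addn_0; lia.
apply: achieves_bind; first exact: achieves_const.
move=> z e0 sz; apply: achieves_bind; first exact: achieves_const.
move=> o e1 so; apply: achieves_bind.
  apply: (achieves_foreach (Q := fun k tab s' => forall l, (l <= L)%N ->
    lists_neighbours (x k) l (nth [::] tab l) s')).
    by move=> k tab s e tabP l lL; apply/lists_neighbours_cat/tabP.
  move=> k e; rewrite mem_iota add0n => /= kL.
  apply: achieves_neighbour_table.
  - by do 2!apply: stores_cat.
  - by do 3!apply: stores_cat; apply: geo.2.
  - by do 3!apply: stores_geometry_cat.
move=> tab e2 tabP; apply: achieves_bind.
  apply: (achieves_foreach (Q := fun i a s' => stores s' a (stored_column i))).
    by move=> i a s e; exact: stores_cat.
  move=> i e; rewrite mem_iota add0n => /= iL.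
  apply: achieves_column => //.
  - by do 3!apply: stores_cat.
  - by do 2!apply: stores_cat.
  - move=> k l kL lL; apply: lists_neighbours_cat.
    have := Forall2_nth 0%N [::] tabP (n := k); rewrite size_iota nth_iota//.
    by move=> /(_ kL); apply.
move=> cols e3 /stores_flatten; rewrite -necessary_coefsE => sc.
exact: achieves_ret.
Qed.

Lemma necessary_coefs_keys : necessary_coefs L coef =
  flatten [seq column_values (coef p.1 p.2) | p <- necessary_keys L N].
Proof.
rewrite necessary_coefsE /stored_column /necessary_keys map_flatten -map_comp.
rewrite -flatten_map_flatten -map_comp; congr flatten; apply/eq_map => i /=.
by rewrite -map_comp.
Qed.

Lemma block_sizesE :
  shape [seq column_values (coef p.1 p.2) | p <- necessary_keys L N] = block_sizes L N.
Proof.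
by rewrite /shape -map_comp; apply/eq_map => p; exact: size_column_values.
Qed.

Lemma size_necessary_coefs : size (necessary_coefs L coef) =
  (\sum_(1 <= l < L.+1) (N l - N l.-1) * \sum_(l <= m < L.+1) N m)%N.
Proof.
rewrite size_flatten /shape -map_comp sumnE big_map; apply: eq_bigr => l _ /=.
rewrite size_flatten /shape -map_comp sumnE big_map.
rewrite (eq_bigr (fun=> \sum_(l <= m < L.+1) N m)%N) => [|i _ /=].
  by rewrite big_const_nat iter_addn_0 mulnC.
rewrite size_flatten /shape -map_comp sumnE big_map; apply: eq_bigr => m _ /=.
by rewrite size_map size_enum_ord.
Qed.

Lemma eval_program_correct f y (M := (\sum_(1 <= l < L.+1) N l)%N) :
  let b := ml_cardinal Phi delta N x L in
  let r := run Phi solver tsolve (eval_program d L N)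
    (evaluation_input delta x L (N L) (necessary_coefs L coef) f y) in
  r.2 = multilevel Phi delta N x L f y :: [seq b i y | i <- iota 0 (N L)] /\
  (r.1 <= 1 + (3 * d + 3) * M + N L * (2 * (B * L)) + 2 * N L)%N.
Proof.
set mem := necessary_coefs L coef => b.
set s := evaluation_input _ _ _ _ _ _ _.
set fs := [seq f (x i) | i <- iota 0 (N L)].
have szfs : size fs = N L by rewrite size_map size_iota.
have szmem : size mem = sumn (block_sizes L N).
  by rewrite /mem necessary_coefs_keys size_flatten block_sizesE.
have sE : s = geometry_input delta x L (N L) ++ mem ++ fs ++ coords y by [].
have szs : size s = (L + N L * d + sumn (block_sizes L N) + N L + d)%N.
  by rewrite sE size_cat size_geometry_input !size_cat szfs szmem size_coords !addnA.
rewrite /eval_program -szs; apply: run_output.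
have geo : stores_geometry s by apply/stores_geometry_cat/geometry_input_stored.
have smem l i : (i < N L)%N -> l \in necessary_levels L N i ->
    stores s (block_addresses d L N i l) (column_values (coef i l)).
  move=> iL lP.
  have key : (i, l) \in necessary_keys L N.
    by apply/allpairsPdep; exists i, l; rewrite mem_iota.
  have := stores_part (geometry_input delta x L (N L)) mem (fs ++ coords y).
  rewrite -sE size_geometry_input szmem /mem necessary_coefs_keys.
  move=> /stores_block => /(_ (index (i, l) (necessary_keys L N))).
  by rewrite block_sizesE (nth_map (i, l)) ?index_mem// nth_index.
have sfs : stores s (iota (L + N L * d + sumn (block_sizes L N)) (N L)) fs.
  have := stores_part (geometry_input delta x L (N L) ++ mem) fs (coords y).
  by rewrite -catA -sE size_cat size_geometry_input szmem szfs.
have sy : stores s (iota (L + N L * d + sumn (block_sizes L N) + N L) d) (coords y).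
  have := stores_part (geometry_input delta x L (N L) ++ mem ++ fs) (coords y) [::].
  have -> : (geometry_input delta x L (N L) ++ mem ++ fs) ++ coords y ++ [::] = s.
    by rewrite cats0 sE -!catA.
  rewrite size_cat size_geometry_input !size_cat szmem szfs.
  by rewrite size_coords !addnA.
have -> : (1 + (3 * d + 3) * M + N L * (2 * (B * L)) + 2 * N L =
  1 + ((3 * d + 3) * M + (\sum_(i <- iota 0 (N L)) 2 * (B * L) + (2 * N L + 0))))%N.
  by rewrite !big_const_seq !count_predT size_iota !iter_addn_0; lia.
apply: achieves_bind; first exact: achieves_const.
move=> z e0 sz; apply: achieves_bind.
  apply: (achieves_neighbour_table (y := y)) => //; first exact: stores_cat.
  exact: stores_geometry_cat.
move=> tab e1 tabP; apply: achieves_bind.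
  apply: (achieves_foreach (Q := fun i a s' => stores s' [:: a] [:: b i y])).
    by move=> i a s' e; exact: stores_cat.
  move=> i e; rewrite mem_iota add0n => /= iL.
  have -> : b i y = \sum_(l <- necessary_levels L N i) expansion (coef i l) y.
    rewrite /b (ml_cardinal_expansion solverP y (ml_coef_block_system solverP i)).
    rewrite expansion_sum_from_level//.
    by have [/andP[_ /leqW]] := level_ofP levN iL.
  apply: achieves_level_sum.
  - by do 2!apply: stores_cat.
  - exact: size_levels.
  - by move=> l; exact: mem_levels.
  - by move=> l lP; do 3!apply: stores_cat; exact: smem.
  - by move=> l lL; apply/lists_neighbours_cat/tabP.
move=> bs e2 /stores_map sbs.
have sfs2 : stores (((s ++ e0) ++ e1) ++ e2)
    (iota (L + N L * d + sumn (block_sizes L N)) (N L)) fs.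
  by do 3!apply: stores_cat.
have szbs : size bs = N L by rewrite (stores_size sbs) size_map size_iota.
apply: achieves_bind.
  apply: achieves_weaken _ (fun _ _ => id) (achieves_dot Phi solver tsolve (z := z) _ _).
  - by rewrite leq_mul2l /= size_zip size_iota szbs minnn.
  - by do 2!apply: stores_cat.
  - move=> pr prin; have [[/allP in1 _] [/allP in2 _]] := (sfs2, sbs).
    rewrite in1 ?in2//.
      by rewrite -[X in _ \in X](@unzip2_zip _ _ (iota (L + N L * d +
        sumn (block_sizes L N)) (N L))) ?size_iota ?szbs//; apply: map_f.
    by rewrite -[X in _ \in X](@unzip1_zip _ _ _ bs) ?size_iota ?szbs//; apply: map_f.
move=> a e3 /=; rewrite (sum_zip_stores sfs2 sbs) => [sa|];
  last by rewrite szfs size_map size_iota.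
apply: achieves_ret; rewrite (multilevel_nodal levN solverP).
apply: (stores_append (l := [:: a]) (v := [:: _])); last exact: stores_cat.
have <- // : \sum_(k < size fs) fs`_k * [seq b i y | i <- iota 0 (N L)]`_k =
  \sum_(i < N L) f (x i) * ml_cardinal Phi delta N x L i y.
rewrite szfs; apply: eq_bigr => k _.
by rewrite !(nth_map 0%N) ?size_iota// nth_iota.
Qed.

End Correctness.

(** * The cost bounds *)

Section CostBounds.
Context {R : realType}.
Implicit Types (n l S G D B k W C E H : R).

(** Here [n], [l], [S] stand for [N_L], [L] and the sum of all [N_l], [tau] for the
    time of all solves of one column, [E] for the logarithm. *)
Lemma coef_cost_le n l S tau G D B k H E :
  1 <= n -> 1 <= l -> 0 <= D -> 0 <= B -> 0 <= k -> 0 <= G -> 0 <= H ->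
  S <= G * n -> tau <= k * S -> l <= H * E ->
  2 + n * (D * S) + n * (S * (2 * (B * l) + 1) + tau)
  <= H * (2 + G * (D + 2 * B + 1 + k)) * n ^+ 2 * E.
Proof.
move=> n1 l1 D0 B0 k0 G0 H0 SG tauS lE.
have n0 : 0 <= n by apply: le_trans n1.
have nn1 : 1 <= n ^+ 2 by rewrite exprn_ege1.
have l0 : 0 <= l by apply: le_trans l1.
pose W := 2 + G * (D + 2 * B + 1 + k).
have W0 : 0 <= W by rewrite addr_ge0// mulr_ge0// !addr_ge0// mulr_ge0.
apply: (@le_trans _ _ (n ^+ 2 * W * l)); last first.
  have -> : H * (2 + G * (D + 2 * B + 1 + k)) * n ^+ 2 * E = n ^+ 2 * W * (H * E).
    by rewrite /W; ring.
  by rewrite ler_wpM2l// mulr_ge0// (le_trans ler01).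
have a1 : n * (D * S) <= n * (D * (G * n)) by rewrite !ler_wpM2l.
have a2 : S * (2 * (B * l) + 1) <= G * n * (2 * (B * l) + 1).
  by rewrite ler_wpM2r// addr_ge0// !mulr_ge0.
have a3 : tau <= k * (G * n) by apply: le_trans tauS _; rewrite ler_wpM2l.
have a4 : n * (S * (2 * (B * l) + 1) + tau)
       <= n * (G * n * (2 * (B * l) + 1) + k * (G * n)).
  by rewrite ler_wpM2l// lerD.
have b1 : 0 <= 2 * (n ^+ 2 * l - 1).
  by rewrite mulr_ge0// subr_ge0 -[1]mulr1 ler_pM.
have b2 : 0 <= n ^+ 2 * G * (D + 1 + k) * (l - 1).
  by rewrite !mulr_ge0 ?subr_ge0// ?exprn_ge0// !addr_ge0.
have -> : n ^+ 2 * W * l = 2 + n * (D * (G * n)) +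
    n * (G * n * (2 * (B * l) + 1) + k * (G * n)) +
    (2 * (n ^+ 2 * l - 1) + n ^+ 2 * G * (D + 1 + k) * (l - 1)).
  by rewrite /W; ring.
by lra.
Qed.

Lemma eval_cost_le n l S G D B H E :
  1 <= n -> 1 <= l -> 0 <= D -> 0 <= B -> 0 <= G -> 0 <= H ->
  S <= G * n -> l <= H * E ->
  1 + D * S + n * (2 * (B * l)) + 2 * n
  <= H * (3 + G * D + 2 * B) * n * E.
Proof.
move=> n1 l1 D0 B0 G0 H0 SG lE.
have n0 : 0 <= n by apply: le_trans n1.
have l0 : 0 <= l by apply: le_trans l1.
pose W := 3 + G * D + 2 * B.
have W0 : 0 <= W by rewrite !addr_ge0// mulr_ge0.
apply: (@le_trans _ _ (n * W * l)); last first.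
  have -> : H * (3 + G * D + 2 * B) * n * E = n * W * (H * E) by rewrite /W; ring.
  by rewrite ler_wpM2l// mulr_ge0.
have a1 : D * S <= D * (G * n) by rewrite ler_wpM2l.
have b1 : 0 <= n * l - 1 by rewrite subr_ge0 -[1]mulr1 ler_pM.
have b2 : 0 <= n * (2 + G * D) * (l - 1).
  by rewrite !mulr_ge0 ?subr_ge0// !addr_ge0// mulr_ge0.
have -> : n * W * l = 1 + D * (G * n) + n * (2 * (B * l)) + 2 * n +
    ((n * l - 1) + n * (2 + G * D) * (l - 1)).
  by rewrite /W; ring.
by lra.
Qed.

End CostBounds.

Theorem corollary3p14 (R : realType) (d : nat) (Omega : set 'rV[R]_d)
    (Phi : 'rV[R]_d -> R) (nu mu c cqu kappa : R)
    (hd : (0 < d)%N) (hOmega : bounded_domain Omega)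
    (hPhi : compact_pd_rbf Phi)
    (hnu : 1 < nu) (hmu : 0 < mu < 1) (hc : 0 < c <= 1) (hcqu : 0 < cqu) :
  exists C : R, 0 < C /\
  forall (L : nat) (N : nat -> nat), level_sizes L N ->
  exists coef_prog eval_prog : program R, solve_free eval_prog /\
  forall x : nat -> 'rV[R]_d, nested_quasi_uniform Omega x mu c cqu L N ->
  let delta := fun l => nu * fill_distance Omega x (N l) in
  forall (solver : forall l, 'cV[R]_(N l) -> 'cV[R]_(N l)) (tsolve : nat -> nat),
  linear_time_solver solver tsolve (interp_mx Phi delta N x) kappa L ->
  exists alpha : nat -> forall l, 'cV[R]_(N l),
  (forall i, (i < N L)%N -> block_system Phi delta x L i (alpha i)) /\
  let mem := necessary_coefs L alpha in
  [/\ let r := run Phi solver tsolve coef_prog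
                 (geometry_input delta x L (N L)) in
      r.2 = mem /\ r.1%:R <= C * (N L)%:R ^+ 2 * ln (N L)%:R,
      (size mem)%:R <=
        C * (\sum_(1 <= l < L.+1) (N l - N l.-1) * \sum_(l <= m < L.+1) N m)%N%:R
    & forall (f : 'rV[R]_d -> R) (y : 'rV[R]_d),
      {within Omega, continuous f} -> Omega y ->
      let b := ml_cardinal Phi delta N x L in
      let A := multilevel Phi delta N x L f in
      let r := run Phi solver tsolve eval_prog
                 (evaluation_input delta x L (N L) mem f y) in
      [/\ A y = \sum_(i < N L) f (x i) * b i y,
          r.2 = A y :: [seq b i y | i <- iota 0 (N L)]
        & r.1%:R <= C * (N L)%:R * ln (N L)%:R]].
Proof.
have [G G0 cardG] := level_card_sum hd hOmega hmu hcqu.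
have [H H0 countH] := level_count_log hd hOmega hmu hcqu.
have [B fewB] := neighbour_count hd hPhi hnu hcqu.
pose D : R := (3 * d + 3)%N%:R.
pose W1 := H * (2 + G * (D + 2 * B%:R + 1 + `|kappa|)).
pose W2 := H * (3 + G * D + 2 * B%:R).
have W10 : 0 <= W1.
  apply: mulr_ge0; first exact: ltW.
  by rewrite addr_ge0// mulr_ge0 ?(ltW G0)// !addr_ge0.
have W20 : 0 <= W2.
  apply: mulr_ge0; first exact: ltW.
  by rewrite !addr_ge0 ?mulr_ge0 ?(ltW G0).
(* The summand 1 is for the space bound, W1 and W2 for the two programs. *)
exists (1 + W1 + W2); split; first by rewrite -addrA ltr_pwDl// addr_ge0.
move=> L N levN; exists (coef_program d L N), (eval_program d L N).
split; first exact: eval_program_solve_free.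
move=> x nqu delta solver tsolve solves.
have solverP l (lL : (0 < l <= L)%N) := (solves l lL).1.
have few l y (lL : (0 < l <= L)%N) := fewB Omega x mu c L N levN nqu l y lL.
have [L0 _ _] := levN.
have [nL1 _ _ _] := level_points levN nqu (l := L) (andb_true_intro (conj L0 (leqnn L))).
have n1 : 1 <= (N L)%:R :> R by rewrite (ler_nat _ 1) ltnW.
have l1 : 1 <= L%:R :> R by rewrite (ler_nat _ 1).
have lnn0 : 0 <= ln (N L)%:R :> R by rewrite ln_ge0.
have SG := cardG c L N x levN nqu.
have lH := countH c L N x levN nqu.
exists (ml_coef Phi delta x L solver); split.
  by move=> i _; exact: ml_coef_block_system.
split.
- have [memE cost] := coef_program_correct tsolve levN solverP few.
  split; first exact: memE.
  apply: (@le_trans _ _ (W1 * (N L)%:R ^+ 2 * ln (N L)%:R)); last first.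
    by rewrite !ler_wpM2r ?exprn_ge0// addrAC lerDr addr_ge0.
  have tauS : (\sum_(1 <= m < L.+1) tsolve m)%N%:R <=
      `|kappa| * (\sum_(1 <= l < L.+1) N l)%N%:R.
    rewrite !natr_sum mulr_sumr big_nat [leRHS]big_nat; apply: ler_sum => m mL.
    apply: le_trans (solves m mL).2 _.
    by rewrite ler_wpM2r// ler_norm.
  have := coef_cost_le n1 l1 (ler0n _ _ : 0 <= D) (ler0n _ B) (normr_ge0 kappa)
    (ltW G0) (ltW H0) SG tauS lH.
  apply: le_trans; move: cost; rewrite -(ler_nat R) => /le_trans; apply.
  rewrite big_split /= -big_distrl /= !(natrD, natrM) /D.
  by rewrite !(natrD, natrM).
- rewrite size_necessary_coefs -[leLHS]mul1r ler_wpM2r// -addrA lerDl.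
  exact: addr_ge0.
move=> f y _ _; split.
- exact: (multilevel_nodal levN solverP).
- by have [] := eval_program_correct tsolve levN solverP few f y.
have [_ cost] := eval_program_correct tsolve levN solverP few f y.
apply: (@le_trans _ _ (W2 * (N L)%:R * ln (N L)%:R)); last first.
  by rewrite !ler_wpM2r// lerDr addr_ge0.
have := eval_cost_le n1 l1 (ler0n _ _ : 0 <= D) (ler0n _ B) (ltW G0) (ltW H0) SG lH.
apply: le_trans; move: cost; rewrite -(ler_nat R) => /le_trans; apply.
by rewrite /D !(natrD, natrM).
Qed.
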